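(* Let $G_0$ be any 5-connected plane graph with $n-1$ vertices and with all faces of length three except for a single face bounded by a 4-cycle $x_1x_2x_3x_4$. Let $G$ be the graph obtained from $G_0$ by adding a new vertex $x_5$ adjacent to all vertices of $G_0$. Then $G$ is a 6-connected graph with $n$ vertices and $4n-11$ edges, and the 5-rooted graph with underlying graph $G$ and root set $\{x_1,\ldots,x_5\}$ does not contain $K_5$ as a rooted minor.
   Context: Graphs are finite, simple and undirected. A model of a graph $H$ in a graph $G$ is a function $\mu$ that maps the vertices of $H$ to pairwise disjoint non-empty subsets of $V(G)$ inducing connected subgraphs of $G$, and maps each edge $e=uv$ of $H$ to an edge $\mu(e)$ of $G$ with one end in $\mu(u)$ and the other end in $\mu(v)$. A $k$-rooted graph is a graph $G$ with a specified set $X_G\subseteq V(G)$ of $k$ vertices, called roots. For a bijection $\pi:V(K_k)\to X_G$, a $\pi$-rooted model of $K_k$ in $G$ is a model $\mu$ of $K_k$ in $G$ such that $\pi(v)\in\mu(v)$ for every $v\in V(K_k)$. $K_k$ is a rooted minor of the $k$-rooted graph $G$ if a $\pi$-rooted model of $K_k$ in $G$ exists for some (equivalently, every) bijection $\pi:V(K_k)\to X_G$. *)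

(* Defs.v *)
From mathcomp Require Import all_boot all_order all_algebra.
From mathcomp Require Import all_classical all_reals all_analysis.

Set Implicit Arguments.
Unset Strict Implicit.
Unset Printing Implicit Defensive.

Import Order.TTheory GRing.Theory Num.Theory.
Import numFieldNormedType.Exports.

(* [{set T}] is always a finite set; [set T] is a set in the sense of
   classical_sets, used only for subsets of the plane. *)

Record graph := Graph {
  vertex :> finType;
  adj : rel vertex;
  adj_sym : symmetric adj;
  adj_irr : irreflexive adj
}.

Definition edges (G : graph) : {set {set G}} :=
  [set e : {set G} |
    [exists u : G, exists v : G, adj u v && (e == [set u; v]%SET)]]%SET.

(* [A] induces a connected subgraph; the empty set is accepted, so
   nonemptiness is required separately wherever it is meant. *)
Definition induces_connected (G : graph) (A : {set G}) : bool :=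
  [forall u in A, forall v in A,
    connect (fun a b => [&& a \in A, b \in A & adj a b]) u v].

Definition k_connected (k : nat) (G : graph) : bool :=
  (k < #|G|)%N &&
  [forall S : {set G}, (#|S| < k)%N ==> induces_connected (~: S)%SET].

Definition is_cycle (G : graph) (c : seq G) : bool :=
  (2 < size c)%N && ucycleb (@adj G) c.

Definition complete_rel (k : nat) : rel 'I_k := fun i j => i != j.

Lemma complete_sym k : symmetric (@complete_rel k).
Proof. by move=> i j; rewrite /complete_rel eq_sym. Qed.

Lemma complete_irr k : irreflexive (@complete_rel k).
Proof. by move=> i; rewrite /complete_rel eqxx. Qed.

Definition complete_graph (k : nat) : graph :=
  Graph (@complete_sym k) (@complete_irr k).

(* [G] plus one new vertex, [None], adjacent to every vertex of [G]. *)
Definition cone_rel (G : graph) : rel (option G) := fun a b =>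
  match a, b with
  | Some u, Some v => adj u v
  | None, None => false
  | _, _ => true
  end.

Lemma cone_sym G : symmetric (@cone_rel G).
Proof. by move=> [u|] [v|] //=; exact: adj_sym. Qed.

Lemma cone_irr G : irreflexive (@cone_rel G).
Proof. by move=> [u|] //=; exact: adj_irr. Qed.

Definition cone (G : graph) : graph := Graph (@cone_sym G) (@cone_irr G).

(* [muE] is constrained only on the edges of [H]. *)
Record is_model (H G : graph) (muV : H -> {set G}) (muE : {set H} -> {set G})
    : Prop := IsModel {
  model_nonempty : forall v, muV v != finset.set0;
  model_disjoint : forall u v, u != v -> [disjoint muV u & muV v];
  model_connected : forall v, induces_connected (muV v);
  model_edge : forall u v, adj u v ->
    muE [set u; v]%SET \in edges G /\
    exists a b, [/\ a \in muV u, b \in muV v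
                  & muE [set u; v]%SET = [set a; b]%SET]
}.

Definition is_rooted_model (k : nat) (G : graph) (pi : complete_graph k -> G)
    (muV : complete_graph k -> {set G})
    (muE : {set complete_graph k} -> {set G}) : Prop :=
  is_model muV muE /\ forall v, pi v \in muV v.

Definition is_rooted (k : nat) (G : graph) (X : {set G}) : Prop := #|X| = k.

(* The first two conjuncts say that [pi] is a bijection from the vertices of
   [complete_graph k] onto [X]. *)
Definition complete_rooted_minor (k : nat) (G : graph) (X : {set G}) : Prop :=
  exists pi : complete_graph k -> G,
    [/\ injective pi,
        [set pi v | v : complete_graph k]%SET = X
      & exists muV muE, is_rooted_model pi muV muE].

Section Plane.
Variable R : realType.
Local Open Scope classical_set_scope.

Definition is_arc (a b : R * R) (A : set (R * R)) : Prop :=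
  exists g : R -> R * R,
    [/\ {within `[0%R, 1%R], continuous g},
        {in `[0%R, 1%R] &, injective g},
        g 0%R = a, g 1%R = b & A = g @` `[0%R, 1%R]].

(* [earc u v] is meaningful only when [u] and [v] are adjacent. *)
Record plane_drawing (G : graph) := PlaneDrawing {
  pos : G -> R * R;
  earc : G -> G -> set (R * R);
  pos_inj : injective pos;
  earc_sym : forall u v, adj u v -> earc u v = earc v u;
  earc_arc : forall u v, adj u v -> is_arc (pos u) (pos v) (earc u v);
  earc_vertex : forall u v w, adj u v -> earc u v (pos w) -> w = u \/ w = v;
  earc_disjoint : forall u v u' v' z, adj u v -> adj u' v' ->
    [set u; v]%SET != [set u'; v']%SET ->
    earc u v z -> earc u' v' z -> exists w, z = pos w
}.

Variables (G : graph) (D : plane_drawing G).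

Definition drawing_support : set (R * R) :=
  [set z | (exists v, z = pos D v) \/
           (exists u v, adj u v /\ earc D u v z)].

Definition is_face (F : set (R * R)) : Prop :=
  exists2 z, (~` drawing_support) z & F = connected_component (~` drawing_support) z.

Definition frontier (F : set (R * R)) : set (R * R) :=
  closure F `\` interior F.

(* [next c v] is the successor of [v] in the cyclic sequence [c]; the arcs
   contain the images of the vertices of [c]. *)
Definition cycle_support (c : seq G) : set (R * R) :=
  [set z | exists2 v, v \in c & earc D v (next c v) z].

Definition bounded_by (F : set (R * R)) (c : seq G) : Prop :=
  is_cycle c /\ frontier F = cycle_support c.

(* The length of a face that is bounded by a cycle, as every face of a
   2-connected plane graph is. *)
Definition face_length (F : set (R * R)) (k : nat) : Prop :=
  exists2 c : seq G, size c = k & bounded_by F c.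

End Plane.

(* Main.v *)
Require Import Defs.
From mathcomp Require Import all_boot all_order all_algebra.
From mathcomp Require Import all_classical all_reals all_analysis.
From mathcomp Require Import ring lra zify.

(* Winding numbers replace the Jordan curve theorem.  A circle-valued function
   is a real function [al] read modulo [2 pi]; it "lifts" on a set if it is
   there congruent to a continuous real function.  The function [ang a] is the
   argument of [z - a].  By lifting of homotopies every circle-valued function
   continuous on the whole plane lifts on compact sets, while [m * ang 0] does
   not lift on a circle unless [m = 0].  Two consequences, both obtained by
   extending a lift over faces with Tietze's theorem, carry all the plane
   topology.

   (1) If [sum n_i * ang a_i] lifts on a compact set, with [sum n_i = 0] and
   the [a_i] in distinct components of its complement, then all [n_i] vanish.

   (2) A circle-valued function on the drawing that lifts on the boundary cycles
   of all faces but one lifts on the whole drawing.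

   Lifting on the drawing means that the integral cochain of winding numbers
   along edges is a coboundary, so by linear algebra (1) gives F + V <= E + 2
   and (2) gives F + V >= E + 2.  Every edge lies on at most two faces by (1)
   applied after deleting the edge, and on at least two by (2), since there is
   no bridge.  Hence 3 F + 1 = 2 E and E = 3 V - 7.

   A rooted K_5 in the cone would give disjoint connected sets P and Q with
   [x1, x3] in P and [x2, x4] in Q.  Let A1, A2 be the two halves of the 4-cycle
   between [x1] and [x3], a in the face F0 and b inside the first edge of a path
   of Q.  Then a and b are not separated by P + A1 nor by P + A2, which meet in
   the connected set P, so [ang a - ang b] lifts on the 4-cycle: this contradicts
   (1), since F0 is a component of its complement. *)

Set Implicit Arguments.
Unset Strict Implicit.
Unset Printing Implicit Defensive.

Import Order.TTheory GRing.Theory Num.Theory.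
Import numFieldNormedType.Exports.

Local Open Scope classical_set_scope.
Local Open Scope ring_scope.

(** * Circle-valued functions and their lifts *)

Section CircleValued.
Variable R : realType.
Implicit Types s t : R.

Definition eqm s t := exists k : int, s = t + k%:~R * (2 * pi).

Lemma eqm_refl s : eqm s s.
Proof. by exists 0; rewrite mul0r addr0. Qed.

Lemma eqm_sym s t : eqm s t -> eqm t s.
Proof. by case=> k ->; exists (- k); rewrite mulrNz; ring. Qed.

Lemma eqm_trans t s u : eqm s t -> eqm t u -> eqm s u.
Proof. by case=> k -> [l ->]; exists (k + l); rewrite intrD; ring. Qed.

Lemma eqmD s t s' t' : eqm s t -> eqm s' t' -> eqm (s + s') (t + t').
Proof. by case=> k -> [l ->]; exists (k + l); rewrite intrD; ring. Qed.

Lemma eqmMz (n : int) s t : eqm s t -> eqm (n%:~R * s) (n%:~R * t).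
Proof. by case=> k ->; exists (n * k); rewrite intrM; ring. Qed.

Lemma eqm_int s (k : int) : eqm (s + k%:~R * (2 * pi)) s.
Proof. by exists k. Qed.

Lemma cos_sin_int t (k : int) :
  cos (t + k%:~R * (2 * pi)) = cos t /\ sin (t + k%:~R * (2 * pi)) = sin t.
Proof.
have h (u : R) (n : nat) :
    cos (u + n%:R * (2 * pi)) = cos u /\ sin (u + n%:R * (2 * pi)) = sin u.
  have -> : n%:R * (2 * pi) = (pi *+ 2) *+ n :> R.
    by rewrite mulr_natl [2 * pi]mulr_natl.
  by rewrite (periodicn (@cosD2pi R)) (periodicn (@sinD2pi R)).
case: k => n; first exact: h.
have [h1 h2] := h (t + (Negz n)%:~R * (2 * pi)) n.+1.
rewrite -h1 -h2 NegzE mulrNz.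
by rewrite mulNr subrK.
Qed.

(** The difference of [s] and [t] has cosine 1. Once a floor has brought it between 0 and 2 pi, it
    or its reflection in pi lies in [0, pi], where the cosine is injective. *)
Lemma eqmP s t : eqm s t <-> cos s = cos t /\ sin s = sin t.
Proof.
split=> [[k ->]|[hc hs]]; first exact: cos_sin_int.
have pi0 := pi_gt0 R.
have p2 : 0 < 2 * pi :> R by lra.
pose d := s - t.
have cd : cos d = 1.
  by rewrite cosB hc hs -!expr2 cos2Dsin2.
pose k := Num.floor (d / (2 * pi)).
have k1 : k%:~R * (2 * pi) <= d by rewrite -ler_pdivlMr // ge_floor.
have k2 : d < (k%:~R + 1) * (2 * pi).
  by rewrite -ltr_pdivrMr // -intrD1 lt_succ_floor ?num_real.
pose e := d - k%:~R * (2 * pi).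
have ce : cos e = 1.
  by have [<- _] := cos_sin_int e k; rewrite /e subrK.
have e0 : 0 <= e by rewrite /e; lra.
have e2 : e < 2 * pi by rewrite /e; lra.
suff ez : e = 0 by exists k; rewrite -[s](subrK t) -/d -[d](subrK (k%:~R * (2 * pi))) -/e ez; ring.
have [le|lt] := leP e pi.
  by apply: cos_inj; rewrite ?in_itv /= ?e0 ?le ?lexx ?(ltW pi0) // ce cos0.
exfalso.
have [h _] := cos_sin_int (- e) 1.
have : 2 * pi - e = 0.
  apply: cos_inj; rewrite ?in_itv /= ?lexx ?(ltW pi0) //.
    by apply/andP; split; lra.
  rewrite cos0; have -> : 2 * pi - e = - e + 1%:~R * (2 * pi) by rewrite mulr1z; ring.
  by rewrite h cosN.
lra.
Qed.

Lemma eqm_cos s t : eqm s t -> cos s = cos t.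
Proof. by case/eqmP. Qed.

Lemma eqm_sin s t : eqm s t -> sin s = sin t.
Proof. by case/eqmP. Qed.

Section Lifts.
Variable T : topologicalType.
Implicit Types (K A B : set T) (al be th : T -> R).

(* A circle-valued function is given by a real function read modulo [2 pi];
   the function itself need not be continuous. *)
Definition ccont K al :=
  {within K, continuous (fun z => cos (al z))} /\
  {within K, continuous (fun z => sin (al z))}.

Definition clift K al :=
  exists2 th, {within K, continuous th} & forall z, K z -> eqm (th z) (al z).

Lemma wcontD K (f g : T -> R) : {within K, continuous f} -> {within K, continuous g} ->
  {within K, continuous (fun z => f z + g z)}.
Proof. by move=> hf hg z; apply: cvgD; [exact: hf|exact: hg]. Qed.

Lemma wcontN K (f : T -> R) : {within K, continuous f} ->
  {within K, continuous (fun z => - f z)}.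
Proof. by move=> hf z; apply: cvgN; exact: hf. Qed.

Lemma wcontM K (f g : T -> R) : {within K, continuous f} -> {within K, continuous g} ->
  {within K, continuous (fun z => f z * g z)}.
Proof. by move=> hf hg z; apply: cvgM; [exact: hf|exact: hg]. Qed.

Lemma wcont_cst K (c : R) : {within K, continuous (fun _ : T => c)}.
Proof. by move=> z; exact: cvg_cst. Qed.

Lemma wcont_comp K (f : T -> R) (g : R -> R) : {within K, continuous f} ->
  continuous g -> {within K, continuous (fun z => g (f z))}.
Proof. by move=> hf hg z; apply: (continuous_comp (hf z)); exact: hg. Qed.

Lemma wcont_eq K (f g : T -> R) : (forall z, K z -> f z = g z) ->
  {within K, continuous f} -> {within K, continuous g}.
Proof.
move=> fg; apply: subspace_eq_continuous => z zK.
by apply: fg; move: zK; rewrite inE.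
Qed.

Lemma ccont_eqm K al be : (forall z, K z -> eqm (al z) (be z)) ->
  ccont K al -> ccont K be.
Proof.
move=> e [h1 h2]; split.
  by apply: wcont_eq h1 => z /e /eqm_cos.
by apply: wcont_eq h2 => z /e /eqm_sin.
Qed.

Lemma clift_eqm K al be : (forall z, K z -> eqm (al z) (be z)) ->
  clift K al -> clift K be.
Proof.
move=> e [th h1 h2]; exists th => // z Kz.
exact: eqm_trans (h2 _ Kz) (e _ Kz).
Qed.

Lemma ccontW A B al : A `<=` B -> ccont B al -> ccont A al.
Proof. by move=> s [h1 h2]; split; exact: continuous_subspaceW h1 || exact: continuous_subspaceW h2. Qed.

Lemma cliftW A B al : A `<=` B -> clift B al -> clift A al.
Proof.
move=> s [th h1 h2]; exists th; first exact: continuous_subspaceW h1.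
by move=> z /s; exact: h2.
Qed.

Lemma wcont_ccont K th : {within K, continuous th} -> ccont K th.
Proof.
by move=> h; split; apply: wcont_comp h _; [exact: continuous_cos|exact: continuous_sin].
Qed.

Lemma clift_wcont K th : {within K, continuous th} -> clift K th.
Proof. by move=> h; exists th => // z _; exact: eqm_refl. Qed.

Lemma ccontD K al be : ccont K al -> ccont K be -> ccont K (fun z => al z + be z).
Proof.
move=> [a1 a2] [b1 b2]; split.
  apply: (@wcont_eq _ (fun z => cos (al z) * cos (be z) + - (sin (al z) * sin (be z)))).
    by move=> z _; rewrite cosD.
  by apply: wcontD; [exact: wcontM|apply: wcontN; exact: wcontM].
apply: (@wcont_eq _ (fun z => sin (al z) * cos (be z) + cos (al z) * sin (be z))).
  by move=> z _; rewrite sinD.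
by apply: wcontD; exact: wcontM.
Qed.

Lemma ccontN K al : ccont K al -> ccont K (fun z => - al z).
Proof.
move=> [a1 a2]; split.
  by apply: wcont_eq a1 => z _; rewrite cosN.
by apply: (@wcont_eq _ (fun z => - sin (al z))) (wcontN a2) => z _; rewrite sinN.
Qed.

Lemma ccont0 K : ccont K (fun=> 0).
Proof. exact/wcont_ccont/wcont_cst. Qed.

Lemma ccontMn K (n : nat) al : ccont K al -> ccont K (fun z => n%:R * al z).
Proof.
move=> h; elim: n => [|n ih].
  by apply: ccont_eqm (ccont0 K) => z _; rewrite mul0r; exact: eqm_refl.
apply: ccont_eqm (ccontD h ih) => z _.
by rewrite -natr1 mulrDl mul1r addrC; exact: eqm_refl.
Qed.

Lemma ccontMz K (n : int) al : ccont K al -> ccont K (fun z => n%:~R * al z).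
Proof.
move=> h; case: n => n; first exact: ccontMn.
by apply: ccont_eqm (ccontN (ccontMn n.+1 h)) => z _; rewrite NegzE mulrNz mulNr; exact: eqm_refl.
Qed.

Lemma ccont_sum K (I : Type) (r : seq I) (al : I -> T -> R) :
  (forall i, ccont K (al i)) -> ccont K (fun z => \sum_(i <- r) al i z).
Proof.
move=> h; elim: r => [|i r ih].
  by apply: ccont_eqm (ccont0 K) => z _; rewrite big_nil; exact: eqm_refl.
by apply: ccont_eqm (ccontD (h i) ih) => z _; rewrite big_cons; exact: eqm_refl.
Qed.

Lemma cliftD K al be : clift K al -> clift K be -> clift K (fun z => al z + be z).
Proof.
move=> [f f1 f2] [g g1 g2]; exists (fun z => f z + g z); first exact: wcontD.
by move=> z Kz; apply: eqmD; [exact: f2|exact: g2].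
Qed.

Lemma cliftMz K (n : int) al : clift K al -> clift K (fun z => n%:~R * al z).
Proof.
move=> [f f1 f2]; exists (fun z => n%:~R * f z).
  by apply: wcontM => //; exact: wcont_cst.
by move=> z Kz; apply: eqmMz; exact: f2.
Qed.

Lemma cliftN K al : clift K al -> clift K (fun z => - al z).
Proof.
by move=> h; apply: clift_eqm (cliftMz (-1) h) => z _; rewrite mulN1r; exact: eqm_refl.
Qed.

Lemma cliftB K al be : clift K al -> clift K be -> clift K (fun z => al z - be z).
Proof. by move=> a b; apply: cliftD => //; exact: cliftN. Qed.

Lemma clift0 K : clift K (fun=> 0).
Proof. exact/clift_wcont/wcont_cst. Qed.

Lemma clift_sum K (I : Type) (r : seq I) (al : I -> T -> R) :
  (forall i, clift K (al i)) -> clift K (fun z => \sum_(i <- r) al i z).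
Proof.
move=> h; elim: r => [|i r ih].
  by apply: clift_eqm (clift0 K) => z _; rewrite big_nil; exact: eqm_refl.
by apply: clift_eqm (cliftD (h i) ih) => z _; rewrite big_cons; exact: eqm_refl.
Qed.

Lemma eqm_atan s : 0 < cos s -> eqm (atan (sin s / cos s)) s.
Proof.
move=> c0; apply/eqmP.
have hc : cos (atan (sin s / cos s)) = cos s.
  rewrite cos_atan.
  have -> : 1 + (sin s / cos s) ^+ 2 = (cos s)^-1 ^+ 2.
    have := cos2Dsin2 s; have : cos s != 0 by lra.
    move=> h1 h2; rewrite expr_div_n -{1}(divff (x := cos s ^+ 2)) ?sqrf_eq0 //.
    by rewrite -mulrDl h2 exprVn div1r.
  by rewrite sqrtr_sqr ger0_norm ?invrK // invr_ge0 ltW.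
split=> //.
have ht := atanK (sin s / cos s); move: ht; rewrite /tan hc.
by move=> /(congr1 (fun x => x * cos s)); rewrite -!mulrA mulVf ?gt_eqF // !mulr1.
Qed.

(** In the open right half-plane the arctangent of the slope is a continuous choice of the
    argument. *)
Lemma clift_near K al : ccont K al -> (forall z, K z -> 0 < cos (al z)) -> clift K al.
Proof.
move=> [h1 h2] pos; exists (fun z => atan (sin (al z) / cos (al z))); last first.
  by move=> z /pos; exact: eqm_atan.
apply: wcont_comp; last exact: continuous_atan.
apply/subspace_continuousP => z Kz; apply: cvgM.
  by move/subspace_continuousP: h2; exact.
apply: cvgV; first by rewrite gt_eqF //; exact: pos.
by move/subspace_continuousP: h1; exact.
Qed.

End Lifts.
End CircleValued.

(** * Lifting homotopies *)

Section WithinContinuity.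
Variables X Y : topologicalType.
Implicit Types (A B : set X) (f : X -> Y).

Lemma within_closedP A f : {within A, continuous f} <->
  forall C, closed C -> exists2 V, closed V & V `&` A = f @^-1` C `&` A.
Proof.
split=> [/continuous_closedP h C /h /closed_subspaceP //|h].
by apply/continuous_closedP => C /h /closed_subspaceP.
Qed.

Lemma within_finite_union (I : finType) (A : I -> set X) f :
  (forall i, closed (A i)) -> (forall i, {within A i, continuous f}) ->
  {within [set z | exists i, A i z], continuous f}.
Proof.
move=> cA cf; apply/within_closedP => C cC.
have /choice [V hV] : forall i, exists V, closed V /\ V `&` A i = f @^-1` C `&` A i.
  by move=> i; have /within_closedP/(_ C cC) [V] := cf i; exists V.
exists (\bigcup_(i in [set: I]) (V i `&` A i)).
  by apply: closed_bigcup => [|i _]; [exact: finite_finset|]; apply: closedI => //; case: (hV i).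
apply/seteqP; split=> z.
  case=> [[i _ VAz]] _; case: (hV i) => _ e.
  by move: VAz; rewrite e => -[? ?]; split => //; exists i.
case=> fz [i Az]; split; last by exists i.
by exists i => //; case: (hV i) => _ ->.
Qed.

Lemma compact_preimage A f C : compact A -> {within A, continuous f} ->
  closed C -> compact (A `&` f @^-1` C).
Proof.
move=> cA /within_closedP h /h [V cV e].
by rewrite setIC -e setIC; exact: compact_closedI.
Qed.

End WithinContinuity.

Lemma within_compose (X Y Z : topologicalType) (A : set X) (B : set Y) (g : X -> Y) (f : Y -> Z) :
  {within A, continuous g} -> (forall x, A x -> B (g x)) -> {within B, continuous f} ->
  {within A, continuous (fun x => f (g x))}.
Proof.
move=> cg gAB cf; apply/within_closedP => C cC.
have /within_closedP/(_ C cC) [V cV eV] := cf.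
have /within_closedP/(_ V cV) [W cW eW] := cg.
exists W => //; rewrite eW; apply/seteqP; split=> x [h Ax]; split => //=.
  have : (V `&` B) (g x) by split => //; exact: gAB.
  by rewrite eV => -[].
have : (f @^-1` C `&` B) (g x) by split => //; exact: gAB.
by rewrite -eV => -[].
Qed.

(** A continuous map from a compact set to a Hausdorff space is closed onto its image, so continuity
    of [f] can be tested after composition with [g]. *)
Lemma within_quotient (X Y Z : topologicalType) (K : set X) (g : X -> Y) (f : Y -> Z) :
  hausdorff_space Y -> compact K -> {within K, continuous g} ->
  {within K, continuous (fun x => f (g x))} -> {within g @` K, continuous f}.
Proof.
move=> hY cK cg cfg; apply/within_closedP => C cC.
have cP := compact_preimage cK cfg cC.
exists (g @` (K `&` (fun x => f (g x)) @^-1` C)).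
  apply: compact_closed => //; apply: continuous_compact cP.
  by apply: continuous_subspaceW cg; exact: subIsetl.
apply/seteqP; split=> y.
  by case=> [[x [Kx Cx] <-]] _; split => //; exists x.
by case=> Cy [x Kx yE]; subst y; split; exists x.
Qed.

Section LiftTheory.
Variable R : realType.

(** Two different values would be multiples of 2 pi; by connectedness the half-integral multiple
    just above the smaller one would be a value too. *)
Lemma connected_int_cst (T : topologicalType) (K : set T) (f : T -> R) :
  connected K -> {within K, continuous f} -> (forall z, K z -> eqm (f z) 0) ->
  forall z w, K z -> K w -> f z = f w.
Proof.
move=> cK cf h; have p0 : 0 < 2 * pi :> R by have := pi_gt0 R; lra.
suff lt z w : K z -> K w -> ~ (f z < f w).
  by move=> z w Kz Kw; apply/eqP; rewrite eq_le !leNgt; apply/andP; split; apply/negP; exact: lt.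
move=> Kz Kw fzw.
have /connected_intervalP ci := connected_continuous_connected cK cf.
have [k fz] := h _ Kz; have [l fw] := h _ Kw; rewrite !add0r in fz fw.
have kl : k%:~R + 1 <= l%:~R :> R.
  by rewrite -intrD1 ler_int lezD1 -(ltr_int R) -(ltr_pM2r p0) -fz -fw.
have Iz : (f @` K) (f z) by exists z.
have Iw : (f @` K) (f w) by exists w.
have bd : f z <= (k%:~R + 2^-1) * (2 * pi) <= f w.
  by apply/andP; split; rewrite ?fz ?fw ler_pM2r //; lra.
have [v Kv fv] := ci _ _ Iz Iw _ bd.
have [m fm] := h _ Kv; rewrite add0r fv in fm.
have /(mulIf (lt0r_neq0 p0)) e := fm.
have h1 : (k < m)%R by rewrite -(ltr_int R) -e; lra.
have h2 : (m < k + 1)%R by rewrite -(ltr_int R) intrD1 -e; lra.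
by move: h1 h2; rewrite ltzD1 ltNge => /negbTE ->.
Qed.

(** The difference of the two functions takes values in the multiples of 2 pi, hence is constant on
    a connected set. *)
Lemma lift_unique (T : topologicalType) (K : set T) (th1 th2 : T -> R) :
  connected K -> {within K, continuous th1} -> {within K, continuous th2} ->
  (forall z, K z -> eqm (th1 z) (th2 z)) ->
  forall z w, K z -> K w -> th1 w - th1 z = th2 w - th2 z.
Proof.
move=> cK c1 c2 h z w Kz Kw.
have := @connected_int_cst _ K (fun z => th1 z + - th2 z) cK (wcontD c1 (wcontN c2)) _ z w Kz Kw.
have h' v : K v -> eqm (th1 v - th2 v) 0.
  by move=> /h [k ->]; exists k; ring.
by move=> /(_ h') e; lra.
Qed.

(** The squared distance between the points of the unit circle at angles [a] and [b] is 2 - 2 cos (a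
    - b), and the hypotheses make it less than 1/2. *)
Lemma cos_close (a b : R) : `|cos a - cos b| < 1 / 2 -> `|sin a - sin b| < 1 / 2 ->
  0 < cos (a - b).
Proof.
have half (x : R) : `|x| < 1 / 2 -> x ^+ 2 < 4^-1.
  by move=> h; rewrite -real_normK ?num_real //; have := normr_ge0 x; nra.
move=> /half hc /half hs; rewrite cosB.
have := cos2Dsin2 a; have := cos2Dsin2 b; lra.
Qed.

(* Homotopy lifting: the increments of a homotopy over a fine subdivision of
   the unit interval lie in the right half-plane, where [atan] gives lifts. *)
Lemma homotopy_lift (T : topologicalType) (K : set T) (be : R * T -> R) :
  compact K -> ccont setT be -> clift K (fun z => be (1, z) - be (0, z)).
Proof.
move=> cK [cc cs].
have cc' : continuous (fun p : R * T => cos (be p)) by apply/continuous_subspace_setT.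
have cs' : continuous (fun p : R * T => sin (be p)) by apply/continuous_subspace_setT.
pose P (N : nat) (p : R * T) := forall s : R, `|s - p.1| < N.+1%:R^-1 ->
  0 < cos (be (s, p.2) - be p).
have cI : compact ((`[0%R, 1%R]%classic : set R) `*` K).
  by apply: compact_setX => //; exact: segment_compact.
(* [T] carries no uniform structure, so a mesh that serves all points at once comes from the
   covering form of compactness of the product. *)
have near : \forall N \near \oo, ((`[0%R, 1%R]%classic : set R) `*` K) `<=` P N.
  apply: (iffLR (compact_near_coveringP _) cI) => -[t0 z0] _.
  have q0 : 0 < 1 / 4 :> R by lra.
  have /cvgrPdist_lt/(_ _ q0) hc := cc' (t0, z0).
  have /cvgrPdist_lt/(_ _ q0) hs := cs' (t0, z0).
  have [[/= I B] [nI nB] IB] := filterI hc hs.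
  have /nbhs_ballP [e /= e0 eI] := nI.
  have e20 : 0 < e / 2 by lra.
  have nI' : nbhs t0 (ball t0 (e / 2)) by exact: nbhsx_ballx.
  exists ((ball t0 (e / 2) `*` B), [set N | N.+1%:R^-1 < e / 2]); first split => /=.
  - by exists (ball t0 (e / 2), B).
  - exact: near_infty_natSinv_lt (PosNum e20).
  move=> [[t z] N] /= [[tt zB] eN] s /= sN.
  have sI : ball t0 e s.
    rewrite -ball_normE /=; move: tt; rewrite -ball_normE /= => tt.
    have := ler_distD t t0 s; have : `|t - s| < e / 2 by rewrite distrC; exact: lt_trans eN.
    lra.
  have tI : ball t0 e t by apply: le_ball tt; lra.
  have [/= c1 s1] := IB (s, z) (conj (eI _ sI) zB).
  have [/= c2 s2] := IB (t, z) (conj (eI _ tI) zB).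
  apply: cos_close.
    have := ler_distD (cos (be (t0, z0))) (cos (be (s, z))) (cos (be (t, z))).
    by rewrite (distrC (cos (be (s, z))) (cos (be (t0, z0)))); lra.
  have := ler_distD (sin (be (t0, z0))) (sin (be (s, z))) (sin (be (t, z))).
  by rewrite (distrC (sin (be (s, z))) (sin (be (t0, z0)))); lra.
have [N _ /(_ N (leqnn N)) hP] := near.
(* One more than [N.+1], so that the step 1/[M] is strictly below the bound in [P N]. *)
pose M := N.+2.
pose tk (k : nat) : R := k%:R / M%:R.
have M0 : 0 < M%:R :> R by rewrite ltr0n.
have cslice (c : R) : ccont setT (fun z : T => be (c, z)).
  have cp : continuous (fun z : T => (c, z)).
    by move=> z; apply: (@cvg_pair _ _ _ (nbhs z) (nbhs c) (nbhs z) _ _ _ (fun=> c) id); [exact: cvg_cst|exact: cvg_id].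
  split; apply: continuous_subspaceT => z.
    exact: (@continuous_comp _ _ _ (fun z => (c, z)) (fun p => cos (be p)) z (cp z) (cc' _)).
  exact: (@continuous_comp _ _ _ (fun z => (c, z)) (fun p => sin (be p)) z (cp z) (cs' _)).
have step k : (k < M)%N -> clift K (fun z => be (tk k.+1, z) - be (tk k, z)).
  move=> kM; apply: clift_near.
    by apply: ccontW (@subsetT _ K) _; apply: ccontD; [exact: cslice|apply: ccontN; exact: cslice].
  move=> z Kz; apply: (hP (tk k, z)).
    split => //=; rewrite in_itv /= /tk divr_ge0 ?ler0n //= ler_pdivrMr // mul1r ler_nat.
    exact: ltnW.
  rewrite /= /tk -mulrBl -natrB // subSnn mul1r ger0_norm ?invr_ge0 ?ler0n //.
  by rewrite ltf_pV2 ?posrE ?ltr0n // ltr_nat.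
(* Padded by 0 from [M] on, because [clift_sum] asks for a lift of every summand. *)
pose G (k : nat) : T -> R := if (k < M)%N then (fun z => be (tk k.+1, z) - be (tk k, z)) else (fun=> 0).
have cG k : clift K (G k).
  by rewrite /G; case: ifP => [/step //|_]; exact: clift0.
apply: clift_eqm (clift_sum (index_iota 0 M) cG) => z _.
have -> : \sum_(i <- index_iota 0 M) G i z = be (1, z) - be (0, z).
  rewrite (eq_big_nat _ _ (F2 := fun i => be (tk i.+1, z) - be (tk i, z))); last first.
    by move=> i /andP[_ iM]; rewrite /G iM.
  by rewrite (telescope_sumr (fun i => be (tk i, z))) // /tk divff ?lt0r_neq0 // mul0r.
exact: eqm_refl.
Qed.

End LiftTheory.

(** * Gluing, and lifts along arcs *)

Section Gluing.
Variables (R : realType) (T : topologicalType).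
Implicit Types (A B K : set T) (al : T -> R).

Lemma ccont_glue (I : finType) (A : I -> set T) al :
  (forall i, closed (A i)) -> (forall i, ccont (A i) al) ->
  ccont [set z | exists i, A i z] al.
Proof.
by move=> cA h; split; apply: within_finite_union => // i; case: (h i).
Qed.

Lemma ccontU A B al : closed A -> closed B -> ccont A al -> ccont B al ->
  ccont (A `|` B) al.
Proof. by move=> cA cB [a1 a2] [b1 b2]; split; apply: withinU_continuous. Qed.

Lemma clift_glue (I : finType) (A : I -> set T) (th : I -> T -> R) al :
  (forall i, closed (A i)) -> (forall i, {within A i, continuous (th i)}) ->
  (forall i j z, A i z -> A j z -> th i z = th j z) ->
  (forall i z, A i z -> eqm (th i z) (al z)) ->
  clift [set z | exists i, A i z] al.
Proof.
move=> cA cth agree h.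
pose t z := if pselect (exists i, A i z) is left e then th (projT1 (cid e)) z else 0.
have tE i z : A i z -> t z = th i z.
  move=> Az; rewrite /t; case: pselect => [e|[]]; last by exists i.
  by apply: agree Az; exact: projT2 (cid e).
exists t.
  apply: within_finite_union => // i.
  by apply: wcont_eq (cth i) => z /tE ->.
by move=> z [i Az]; rewrite (tE i) //; exact: h.
Qed.

(** On the connected overlap the two lifts differ by a constant multiple [d] of 2 pi; shifting one
    of them by [d] makes them agree. An empty overlap needs no shift. *)
Lemma clift_union A B al : closed A -> closed B -> connected (A `&` B) ->
  clift A al -> clift B al -> clift (A `|` B) al.
Proof.
move=> cA cB cAB [t1 c1 h1] [t2 c2 h2].
have [d [k dE] hd] : exists2 d : R, eqm d 0 & forall z, (A `&` B) z -> t1 z = t2 z + d.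
  have [[p [Ap Bp]]|ne] := pselect (exists p, (A `&` B) p); last first.
    by exists 0; [exact: eqm_refl|move=> z hz; case: ne; exists z].
  exists (t1 p - t2 p).
    have [k ->] := eqm_trans (h1 _ Ap) (eqm_sym (h2 _ Bp)); exists k; ring.
  move=> z [Az Bz].
  have := @lift_unique _ _ (A `&` B) t1 t2 cAB
    (continuous_subspaceW (@subIsetl _ A B) c1)
    (continuous_subspaceW (@subIsetr _ A B) c2).
  move=> /(_ _ p z (conj Ap Bp) (conj Az Bz)) h.
  have h' w : (A `&` B) w -> eqm (t1 w) (t2 w).
    by case=> Aw Bw; exact: eqm_trans (h1 _ Aw) (eqm_sym (h2 _ Bw)).
  by rewrite -[t1 z](subrK (t1 p)) (h h'); ring.
have := @clift_glue bool (fun b => if b then A else B)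
  (fun b => if b then t1 else (fun z => t2 z + d)) al.
have -> : [set z | exists i : bool, (if i then A else B) z] = A `|` B.
  apply/seteqP; split=> z; first by case=> -[]; [left|right].
  by case=> ?; [exists true|exists false].
apply.
- by case.
- by case => //; apply: wcontD => //; exact: wcont_cst.
- move=> [] [] z // ? ?; first exact: hd.
  by apply/esym/hd.
- move=> [] z; first exact: h1.
  by move/h2 => h; rewrite -[al z]addr0; apply: eqmD => //; exists k.
Qed.

End Gluing.

Lemma fst_continuous (T U : topologicalType) : continuous (@fst T U).
Proof. by case=> x y; exact: cvg_fst. Qed.

Lemma snd_continuous (T U : topologicalType) : continuous (@snd T U).
Proof. by case=> x y; exact: cvg_snd. Qed.

Section Arcs.
Variable R : realType.
Implicit Types (al : R * R -> R) (A : set (R * R)).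

Lemma prod_hausdorff : hausdorff_space (R * R)%type.
Proof. exact: norm_hausdorff. Qed.

(** Retracting the line onto the unit interval extends the parametrization [g] to the whole line,
    still with values in the arc; [h] reads off the parameter. *)
Lemma is_arcP (a b : R * R) A : is_arc a b A -> exists (g : R -> R * R) (h : R * R -> R),
  [/\ continuous g, (forall t, A (g t)), (forall t, 0 <= t <= 1 -> h (g t) = t),
     g 0 = a /\ g 1 = b & A = g @` `[0%R, 1%R]].
Proof.
case=> g [cg ig g0 g1 AE].
(* The retraction onto [0, 1], written with absolute values so that its continuity is immediate. *)
pose cl (t : R) := (`|t| - `|t - 1| + 1) / 2.
have clE t : 0 <= t <= 1 -> cl t = t.
  case/andP => t0 t1; rewrite /cl ger0_norm // ler0_norm; [lra|lra].
have cl01 t : 0 <= cl t <= 1.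
  rewrite /cl; case: (ger0P t) => t0; case: (ger0P (t - 1)) => t1; apply/andP; split; lra.
have ccl : continuous cl.
  move=> t; apply: cvgM; last exact: cvg_cst.
  apply: cvgD; last exact: cvg_cst.
  apply: cvgB; first exact: norm_continuous.
  apply: cvg_norm; apply: cvgB; [exact: cvg_id|exact: cvg_cst].
have in01 t : 0 <= t <= 1 -> (`[0%R, 1%R]%classic : set R) t by rewrite /= in_itv.
exists (fun t => g (cl t)), (fun z => xget 0 [set x | 0 <= x <= 1 /\ g x = z]); split.
- have := @within_compose _ _ _ setT (`[0%R, 1%R]%classic : set R) cl g (continuous_subspaceT ccl) _ cg.
  by move=> h; apply/continuous_subspace_setT; apply: h => t _; exact: in01.
- by move=> t; rewrite AE; exists (cl t) => //; exact: in01.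
- move=> t t01; rewrite clE //.
  case: xgetP => [x _ [x01 gx]|/(_ t) []//].
  by apply: ig gx; rewrite inE /= in_itv.
- by rewrite !clE ?lexx ?ler01.
- rewrite AE; apply/seteqP; split => z [t t01 <-]; exists t => //;
  by move: t01; rewrite /= in_itv /= => /clE ->.
Qed.

Lemma arc_compact a b A : is_arc a b A -> compact A.
Proof.
case=> g [cg _ _ _ ->]; apply: continuous_compact => //; exact: segment_compact.
Qed.

Lemma arc_closed a b A : is_arc a b A -> closed A.
Proof. by move=> /arc_compact; apply: compact_closed; exact: prod_hausdorff. Qed.

Lemma arc_connected a b A : is_arc a b A -> connected A.
Proof.
case=> g [cg _ _ _ ->]; apply: connected_continuous_connected => //.
exact: segment_connected.
Qed.

Lemma arc_ends a b A : is_arc a b A -> A a /\ A b.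
Proof.
by case=> g [_ _ <- <- ->]; split; [exists 0|exists 1]; rewrite //= in_itv /= ?lexx ?ler01.
Qed.

(** The parametrization of an arc is a quotient map, by compactness of the interval, so a continuous
    function of the parameter is continuous on the arc. *)
Lemma arc_descend (A : set (R * R)) (g : R -> R * R) (h : R * R -> R) (th : R -> R) :
  continuous g -> (forall t, 0 <= t <= 1 -> h (g t) = t) -> A = g @` `[0%R, 1%R] ->
  {within `[0%R, 1%R], continuous th} -> {within A, continuous (fun z => th (h z))}.
Proof.
move=> cg hg -> cth; apply: within_quotient.
- exact: prod_hausdorff.
- exact: segment_compact.
- exact: continuous_subspaceT.
- by apply: wcont_eq cth => t; rewrite /= in_itv /= => /hg ->.
Qed.

Lemma arc_param a b A : is_arc a b A ->
  exists h : R * R -> R, [/\ {within A, continuous h}, h a = 0 & h b = 1].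
Proof.
move=> /is_arcP [g [h [cg Ag hg [ga gb] AE]]]; exists h; split.
- apply: (@arc_descend A g h id) => //; apply: continuous_subspaceT => x; exact: cvg_id.
- by rewrite -ga hg // lexx ler01.
- by rewrite -gb hg // lexx ler01.
Qed.

(** The arc is contracted to its first end by scaling the parameter; lifting this homotopy lifts
    [al] minus its value at that end. *)
Lemma arc_lift a b A al : is_arc a b A -> ccont A al -> clift A al.
Proof.
move=> /is_arcP [g [h [cg Ag hg [ga gb] AE]]] [c1 c2].
pose be (p : R * R) := al (g (p.1 * p.2)).
have cm : continuous (fun p : R * R => g (p.1 * p.2)).
  move=> p; apply: (@continuous_comp _ _ _ (fun p : R * R => p.1 * p.2) g); last exact: cg.
  by apply: cvgM; [exact: fst_continuous|exact: snd_continuous].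
have cbe : ccont setT be.
  have cmT : {within setT, continuous (fun p : R * R => g (p.1 * p.2))}.
    exact: continuous_subspaceT.
  by split; [apply: (@within_compose _ _ _ _ A _ (fun z => cos (al z)) cmT)
            |apply: (@within_compose _ _ _ _ A _ (fun z => sin (al z)) cmT)].
have [th cth hth] := homotopy_lift (@segment_compact R 0 1) cbe.
exists (fun z => th (h z) + al (g 0)).
  apply: wcontD; last exact: wcont_cst.
  exact: arc_descend AE cth.
move=> z; rewrite AE => -[t t01 <-].
have t01' : 0 <= t <= 1 by move: t01; rewrite /= in_itv.
rewrite hg //; have := hth _ t01; rewrite /be /= mul1r mul0r => e.
by rewrite -[al (g t)](subrK (al (g 0))); apply: eqmD e (eqm_refl _).
Qed.

End Arcs.

(** * Arguments in the plane *)

Section Plane.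
Variable R : realType.
Local Notation P := (R * R)%type.
Implicit Types (K U : set P) (a b z : P).

(** The Euclidean norm; the norm of the product space [R * R] is the maximum norm. *)
Definition hyp z : R := Num.sqrt (z.1 ^+ 2 + z.2 ^+ 2).

Lemma hyp_gt0 z : z != 0 -> 0 < hyp z.
Proof.
case: z => x y nz; rewrite sqrtr_gt0 /=.
have [x0|x0] := eqVneq x 0; last by rewrite ltr_wpDr ?sqr_ge0 // exprn_even_gt0.
have [y0|y0] := eqVneq y 0; first by rewrite x0 y0 eqxx in nz.
by rewrite ltr_wpDl ?sqr_ge0 // exprn_even_gt0.
Qed.

Lemma hypE z : hyp z ^+ 2 = z.1 ^+ 2 + z.2 ^+ 2.
Proof. by rewrite sqr_sqrtr // addr_ge0 ?sqr_ge0. Qed.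

Lemma polar_exists z : z != 0 ->
  exists t, cos t = z.1 / hyp z /\ sin t = z.2 / hyp z.
Proof.
move=> nz; have h0 := hyp_gt0 nz.
pose x := z.1 / hyp z; pose y := z.2 / hyp z.
have xy : x ^+ 2 + y ^+ 2 = 1.
  by rewrite !expr_div_n -mulrDl -hypE divff // sqrf_eq0 gt_eqF.
have x1 : -1 <= x <= 1 by have := sqr_ge0 y; move: xy => /= xy hy; apply/andP; split; nra.
have sy : Num.sqrt (1 - x ^+ 2) = `|y|.
  by rewrite -xy addrAC subrr add0r sqrtr_sqr.
rewrite -/x -/y; have [y0|y0] := leP 0 y.
  exists (acos x); rewrite acosK ?in_itv //; split => //.
  by rewrite sin_acos // sy ger0_norm.
exists (- acos x); rewrite cosN acosK ?in_itv //; split => //.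
by rewrite sinN sin_acos // sy ltr0_norm // opprK.
Qed.

(* A (discontinuous) choice of the argument of [z - a]. *)
Definition ang a z : R :=
  xget 0 [set t | cos t = (z - a).1 / hyp (z - a) /\ sin t = (z - a).2 / hyp (z - a)].

Lemma angE a z : z != a ->
  cos (ang a z) = (z - a).1 / hyp (z - a) /\ sin (ang a z) = (z - a).2 / hyp (z - a).
Proof.
rewrite -subr_eq0 => /polar_exists [t ht].
by rewrite /ang; case: xgetP => [u _ hu|/(_ t) []].
Qed.

(** The scalar product of [z - a] and [z - b] is the product of their lengths with the cosine of the
    difference of their arguments. *)
Lemma cos_angB a b z : z != a -> z != b ->
  0 < (z - a).1 * (z - b).1 + (z - a).2 * (z - b).2 -> 0 < cos (ang a z - ang b z).
Proof.
move=> za zb pos; have [ca sa] := angE za; have [cb sb] := angE zb.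
have ha : 0 < hyp (z - a) by rewrite hyp_gt0 // subr_eq0.
have hb : 0 < hyp (z - b) by rewrite hyp_gt0 // subr_eq0.
rewrite cosB ca sa cb sb.
have -> : (z - a).1 / hyp (z - a) * ((z - b).1 / hyp (z - b)) +
   (z - a).2 / hyp (z - a) * ((z - b).2 / hyp (z - b)) =
   ((z - a).1 * (z - b).1 + (z - a).2 * (z - b).2) / (hyp (z - a) * hyp (z - b)).
  by field; rewrite !gt_eqF.
by rewrite divr_gt0 // mulr_gt0.
Qed.

Lemma ccont_ang K a : ~ K a -> ccont K (ang a).
Proof.
move=> Ka.
have cfst : continuous (fun z : P => (z - a).1).
  by move=> z; apply: cvgB; [exact: fst_continuous|exact: cvg_cst].
have csnd : continuous (fun z : P => (z - a).2).
  by move=> z; apply: cvgB; [exact: snd_continuous|exact: cvg_cst].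
have chyp : continuous (fun z : P => hyp (z - a)).
  move=> z; apply: (@continuous_comp _ _ _ (fun z : P => (z - a).1 * (z - a).1 + (z - a).2 * (z - a).2) Num.sqrt); last exact: sqrt_continuous.
  by apply: cvgD; apply: cvgM; exact: cfst || exact: csnd.
have Kz z : K z -> z != a by move=> Kz; apply/eqP => e; apply: Ka; rewrite -e.
have gen (f : P -> R) : continuous f -> {within K, continuous (fun z => f z / hyp (z - a))}.
  move=> cf; apply: continuous_in_subspaceT => z; rewrite inE => /Kz za.
  apply: cvgM; first exact: cf.
  apply: cvgV; last exact: chyp.
  by rewrite gt_eqF // hyp_gt0 // subr_eq0.
split.
  by apply: wcont_eq (gen _ cfst) => z /Kz /angE [->].
by apply: wcont_eq (gen _ csnd) => z /Kz /angE [_ ->].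
Qed.

Lemma clift_angB K a b : ~ K a -> ~ K b ->
  (forall z, K z -> 0 < (z - a).1 * (z - b).1 + (z - a).2 * (z - b).2) ->
  clift K (fun z => ang a z - ang b z).
Proof.
move=> Ka Kb h; apply: clift_near.
  by apply: ccontD; [exact: ccont_ang|apply: ccontN; exact: ccont_ang].
move=> z Kz; apply: cos_angB; last exact: h.
  by apply/eqP => e; apply: Ka; rewrite -e.
by apply/eqP => e; apply: Kb; rewrite -e.
Qed.

(** The plane is contracted radially to the origin, and this homotopy is lifted. *)
Lemma plane_lift K (al : P -> R) : compact K -> ccont setT al -> clift K al.
Proof.
move=> cK [c1 c2].
pose m (p : R * P) : P := (p.1 * p.2.1, p.1 * p.2.2).
have cm : continuous m.
  move=> p; apply: (@cvg_pair _ _ _ (nbhs p) (nbhs (p.1 * p.2.1)) (nbhs (p.1 * p.2.2)) _ _ _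
    (fun p => p.1 * p.2.1) (fun p => p.1 * p.2.2)).
    apply: cvgM; first exact: fst_continuous.
    by apply: (@continuous_comp _ _ _ (@snd R P) (@fst R R)); [exact: snd_continuous|exact: fst_continuous].
  apply: cvgM; first exact: fst_continuous.
  by apply: (@continuous_comp _ _ _ (@snd R P) (@snd R R)); exact: snd_continuous.
have cbe : ccont setT (fun p => al (m p)).
  have cmT : {within setT, continuous m} by exact: continuous_subspaceT.
  by split; [apply: (@within_compose _ _ _ _ setT _ (fun z => cos (al z)) cmT)
            |apply: (@within_compose _ _ _ _ setT _ (fun z => sin (al z)) cmT)].
have h := homotopy_lift cK cbe.
have h2 := cliftD h (clift_wcont (@wcont_cst R _ K (al (0, 0)))).
apply: (clift_eqm _ h2) => z _.
rewrite /m /= !mul1r !mul0r subrK -surjective_pairing; exact: eqm_refl.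
Qed.

Definition circ (r t : R) : P := (r * cos t, r * sin t).
Definition circle (r : R) : set P := range (circ r).

Lemma circ_continuous r : continuous (circ r).
Proof.
move=> t; apply: (@cvg_pair _ _ _ (nbhs t) (nbhs (r * cos t)) (nbhs (r * sin t)) _ _ _
    (fun t => r * cos t) (fun t => r * sin t)); apply: cvgM.
- exact: cvg_cst.
- exact: continuous_cos.
- exact: cvg_cst.
- exact: continuous_sin.
Qed.

Lemma connected_R : connected [set: R].
Proof. by apply/connected_intervalP => x y _ _ z _. Qed.

Lemma circle_connected r : connected (circle r).
Proof.
apply: connected_continuous_connected; first exact: connected_R.
by apply: continuous_subspaceT; exact: circ_continuous.
Qed.

Lemma hyp_circ r t : 0 < r -> hyp (circ r t) = r.
Proof.
move=> r0; rewrite /hyp /= !exprMn -mulrDr cos2Dsin2 mulr1 sqrtr_sqr gtr0_norm //.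
Qed.

Lemma circ_neq0 r t : 0 < r -> circ r t != 0.
Proof.
move=> r0; apply/eqP => e; have := hyp_circ t r0; rewrite e /hyp /=.
by rewrite expr0n /= addr0 sqrtr0 => e0; rewrite e0 ltxx in r0.
Qed.

Lemma ang_circ r t : 0 < r -> eqm (ang 0 (circ r t)) t.
Proof.
move=> r0; apply/eqmP; have [-> ->] := angE (circ_neq0 t r0).
by rewrite subr0 hyp_circ //= ![r * _]mulrC !mulfK ?gt_eqF.
Qed.

(* This replaces Brouwer's theorem in the plane. *)
Lemma circle_nolift r (m : int) : 0 < r ->
  clift (circle r) (fun z => m%:~R * ang 0 z) -> m = 0.
Proof.
move=> r0 [th cth h].
(* Along the parametrization the lift differs from [m * t] by a constant, yet it takes equal values
   at 0 and at 2 pi. *)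
have cc : {within setT, continuous (fun t => th (circ r t) + - (m%:~R * t))}.
  apply: wcontD.
    apply: within_compose cth; first by apply: continuous_subspaceT; exact: circ_continuous.
    by move=> t _; exists t.
  apply: wcontN; apply: wcontM; first exact: wcont_cst.
  by apply: continuous_subspaceT => x; exact: cvg_id.
have e t : [set: R] t -> eqm (th (circ r t) + - (m%:~R * t)) 0.
  move=> _; rewrite -(subrr (m%:~R * t)); apply: eqmD (eqm_refl _).
  have Ct : circle r (circ r t) by exists t.
  apply: eqm_trans (h _ Ct) _; apply: eqmMz; exact: ang_circ.
have := connected_int_cst connected_R cc e (z := 0) (w := 2 * pi) I I.
have -> : circ r (2 * pi) = circ r 0.
  by rewrite /circ mulr_natl cos2pi sin2pi cos0 sin0.
rewrite mulr0 => /addrI /oppr_inj /esym /eqP.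
by rewrite mulf_eq0 (gt_eqF (_ : 0 < 2 * pi)) ?orbF ?intr_eq0 => [/eqP //|]; have := pi_gt0 R; lra.
Qed.

(** Seen from a point of the circle, the centre and a point [a] near the centre lie in directions
    that make an acute angle. *)
Lemma circle_ang r a : 0 < r -> `|a.1| < r / 2 -> `|a.2| < r / 2 ->
  clift (circle r) (fun z => ang a z - ang 0 z).
Proof.
move=> r0 a1 a2.
have pos z : circle r z -> 0 < (z - a).1 * (z - 0).1 + (z - a).2 * (z - 0).2.
  case=> t _ <-; rewrite subr0 /=.
  have := cos2Dsin2 t; set c := cos t; set s := sin t => cs.
  have h : 0 < r - (a.1 * c + a.2 * s).
    have h (x y : R) : `|y| <= 1 -> x * y <= `|x|.
      by move=> y1; apply: le_trans (ler_norm _) _; rewrite normrM ler_piMr.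
    have := h a.1 c (cos_max _); have := h a.2 s (sin_max _); lra.
  have -> : (r * c - a.1) * (r * c) + (r * s - a.2) * (r * s) =
     r * (r * (c ^+ 2 + s ^+ 2) - (a.1 * c + a.2 * s)) by ring.
  by rewrite cs mulr1 mulr_gt0.
apply: clift_angB => //.
  by move=> /pos; rewrite subrr /= !mul0r addr0 ltxx.
by move=> /pos; rewrite subrr /= !mulr0 addr0 ltxx.
Qed.

End Plane.

(** * Separation in the plane *)

Section PlaneSeparation.
Variable R : realType.
Local Notation P := (R * R)%type.
Implicit Types (K U C : set P) (a b z : P).

Definition seg z w (t : R) : P := (z.1 + t * (w.1 - z.1), z.2 + t * (w.2 - z.2)).

Lemma seg_continuous z w : continuous (seg z w).
Proof.
move=> t; apply: (@cvg_pair _ _ _ (nbhs t) (nbhs (z.1 + t * (w.1 - z.1))) (nbhs (z.2 + t * (w.2 - z.2)))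
   _ _ _ (fun t => z.1 + t * (w.1 - z.1)) (fun t => z.2 + t * (w.2 - z.2)));
  (apply: cvgD; [exact: cvg_cst|apply: cvgM; [exact: cvg_id|exact: cvg_cst]]).
Qed.

Lemma ball_connected z (e : R) : connected (ball z e).
Proof.
have [e0|e0] := leP e 0; first by rewrite le0_ball0 //; exact: connected0.
have -> : ball z e = \bigcup_(w in ball z e) (seg z w @` `[0%R, 1%R]).
  apply/seteqP; split=> [w zw|w [v [v1 v2] [t]]].
    exists w => //; exists 1; first by rewrite /= in_itv /= ler01 lexx.
    by rewrite /seg !mul1r ![_ + (_ - _)]addrC !subrK -surjective_pairing.
  rewrite /= in_itv /= => /andP[t0 t1] <-.
  have aux (x y : R) : ball x e y -> ball x e (x + t * (y - x)).
    rewrite -!ball_normE /= => h.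
    have -> : x - (x + t * (y - x)) = t * (x - y) by ring.
    by rewrite normrM ger0_norm //; apply: le_lt_trans h; rewrite ler_piMl.
  by split; apply: aux.
apply: bigcup_connected.
  exists z => w _; exists 0; first by rewrite /= in_itv /= ler01 lexx.
  by rewrite /seg !mul0r !addr0 -surjective_pairing.
move=> w _; apply: connected_continuous_connected; first exact: segment_connected.
by apply: continuous_subspaceT; exact: seg_continuous.
Qed.

Lemma ball_off_closed K z : closed K -> ~ K z -> exists2 e : R, 0 < e & ball z e `<=` ~` K.
Proof.
move=> cK Kz.
have : nbhs z (~` K) by apply: open_nbhs_nbhs; split => //; exact: closed_openC.
by case/nbhs_ballP => e /= e0 h; exists e.
Qed.

Lemma component_open K z0 : closed K -> open (connected_component (~` K) z0).
Proof.
rewrite openE => cK z zU.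
have Kz : (~` K) z by exact: connected_component_sub zU.
have [e e0 eK] := ball_off_closed cK Kz.
apply/nbhs_ballP; exists e => //= w zw.
apply: connected_component_trans zU _.
by apply: (@connected_component_max _ _ (ball z e)) => //; [exact: ballxx|exact: ball_connected].
Qed.

(** A point off the closed set [K] has a ball off [K], and this ball lies in a single component. *)
Lemma component_closure K z0 : closed K ->
  closure (connected_component (~` K) z0) `<=` connected_component (~` K) z0 `|` K.
Proof.
move=> cK z zU; have [Kz|Kz] := pselect (K z); [by right|left].
have [e e0 eK] := ball_off_closed cK Kz.
have nb : nbhs z (ball z e) by exact: nbhsx_ballx.
have [w [wU zw]] := zU _ nb.
apply: connected_component_trans wU _.
by apply: (@connected_component_max _ _ (ball z e)) => //; [exact: ball_connected|exact: ballxx].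
Qed.

(** On [C] the set [U] is relatively open and, since its closure adds only points of [K], relatively
    closed. *)
Lemma connected_side K U C : connected C -> (forall z, C z -> ~ K z) -> open U ->
  closure U `<=` U `|` K -> (forall z, C z -> U z) \/ (forall z, C z -> ~ U z).
Proof.
move=> cC CK oU cU.
have [[p [Cp Up]]|ne] := pselect (exists p, C p /\ U p); last first.
  by right => z Cz Uz; apply: ne; exists z.
left; suff <- : C `&` U = C by move=> z [].
apply: cC; first by exists p.
  by exists U.
exists (closure U); first exact: closed_closure.
apply/seteqP; split => z [Cz]; first by split => //; exact: subset_closure.
by case/cU => // /CK.
Qed.

(** Used with [u] = [z - x] and [d] = [x - y], where [z] has maximum distance at least [e] from [x]
    and [y] is within [e / 2] of [x]: the vectors from [x] and from [y] to [z] then make an acute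
    angle. *)
Lemma dot_gt0 (u1 u2 d1 d2 e : R) : 0 < e -> `|d1| < e / 2 -> `|d2| < e / 2 ->
  e <= `|u1| \/ e <= `|u2| -> 0 < u1 * (u1 + d1) + u2 * (u2 + d2).
Proof.
move=> e0 h1 h2 h.
have aux (u d : R) : `|d| < e / 2 -> `|u| ^+ 2 - `|u| * (e / 2) <= u * (u + d).
  move=> hd; rewrite real_normK ?num_real // mulrDr expr2 lerD2l lerNl.
  apply: le_trans (ler_norm _) _; rewrite normrN normrM ler_wpM2l // ltW //.
have := aux u1 _ h1; have := aux u2 _ h2.
move: h (normr_ge0 u1) (normr_ge0 u2); move: `|u1| `|u2| => A B h A0 B0 k2 k1.
suff : 0 < A ^+ 2 - A * (e / 2) + (B ^+ 2 - B * (e / 2)) by lra.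
by case: h => h; have := sqr_ge0 (A - B); nra.
Qed.

(* The set of points that are not separated from [a] by lifts is open, and so
   is its complement in [~` K]. *)
Lemma clift_same_component K U a b : closed K -> connected U -> U `<=` ~` K ->
  U a -> U b -> clift K (fun z => ang a z - ang b z).
Proof.
move=> cK cU UK Ua Ub.
have loc x : ~ K x -> exists2 e : R, 0 < e & forall y, ball x e y -> clift K (fun z => ang x z - ang y z).
  move=> Kx; have [e e0 eK] := ball_off_closed cK Kx.
  exists (e / 2) => [|y xy]; first by rewrite divr_gt0.
  apply: clift_angB => //.
    by apply: eK; apply: le_ball xy; lra.
  move=> z Kz.
  have : ~ ball x e z by move=> /eK.
  case: x y z {Kx eK Kz} xy => [x1 x2] [y1 y2] [z1 z2].
  rewrite /ball /= /prod_ball /= -!ball_normE /= => -[h1 h2] h.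
  have -> : z1 - y1 = (z1 - x1) + (x1 - y1) by ring.
  have -> : z2 - y2 = (z2 - x2) + (x2 - y2) by ring.
  apply: (dot_gt0 e0) => //.
  by rewrite ![`|_ - x1|]distrC ![`|_ - x2|]distrC; case: (leP e `|x1 - z1|) => h3; [left|right; rewrite leNgt; apply/negP => h4; apply: h].
have sepsym x y : clift K (fun z => ang x z - ang y z) -> clift K (fun z => ang y z - ang x z).
  move=> /cliftN h; apply: clift_eqm h => z _; rewrite opprB; exact: eqm_refl.
have septr x y w : clift K (fun z => ang x z - ang y z) -> clift K (fun z => ang y z - ang w z) ->
    clift K (fun z => ang x z - ang w z).
  move=> h1 h2; apply: clift_eqm (cliftD h1 h2) => z _; rewrite addrA subrK; exact: eqm_refl.
pose S : set P := [set x | ~ K x /\ clift K (fun z => ang a z - ang x z)].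
pose S' : set P := [set x | ~ K x /\ ~ clift K (fun z => ang a z - ang x z)].
have oS : open S.
  rewrite openE =>  x [Kx hx]; have [e e0 he] := loc x Kx; have [d d0 hd] := ball_off_closed cK Kx.
  apply/nbhs_ballP; exists (Num.min e d); first by rewrite /= lt_min e0.
  move=> y xy; split; first by apply: hd; apply: le_ball xy; rewrite ge_min lexx orbT.
  by apply: septr hx (he _ _); apply: le_ball xy; rewrite ge_min lexx.
have oS' : open S'.
  rewrite openE => x [Kx hx]; have [e e0 he] := loc x Kx; have [d d0 hd] := ball_off_closed cK Kx.
  apply/nbhs_ballP; exists (Num.min e d); first by rewrite /= lt_min e0.
  move=> y xy; split; first by apply: hd; apply: le_ball xy; rewrite ge_min lexx orbT.
  move=> hy; apply: hx; apply: septr hy (sepsym _ _ (he _ _)).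
  by apply: le_ball xy; rewrite ge_min lexx.
have : U `&` S = U.
  apply: cU.
  - exists a; split => //; split; first exact: UK.
    by apply: clift_eqm (@clift0 R _ K) => z _; rewrite subrr; exact: eqm_refl.
  - by exists S.
  - exists (~` S'); first exact: open_closedC.
    apply/seteqP; split=> z [Uz].
      by case=> _ h; split => // -[_ /(_ h)].
    move=> h; split => //; split; first exact: UK.
    by apply: contrapT => h'; apply: h; split => //; exact: UK.
by move/seteqP=> [_ /(_ b Ub)] [_ []].
Qed.

Lemma tietze K (th : P -> R) : compact K -> {within K, continuous th} ->
  exists2 g : P -> R, continuous g & forall z, K z -> g z = th z.
Proof.
move=> cK cth.
have cim : compact (th @` K) by exact: continuous_compact.
have [M [_ hM]] := compact_bounded cim.
have M0 : 0 < Num.max (M + 1) 1 by rewrite lt_max ltr01 orbT.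
have hM' z : K z -> `|th z| <= Num.max (M + 1) 1.
  move=> Kz; apply: (hM (Num.max (M + 1) 1)); last by exists z.
  by rewrite lt_max ltrDl ltr01.
have nP : normal_space P by exact: pseudometric_normal.
have cKl : closed K by apply: compact_closed => //; exact: prod_hausdorff.
have [g [g1 g2 _]] := continuous_bounded_extension nP cKl M0 cth hM'.
by exists g => // z Kz; rewrite g1 // inE.
Qed.

Lemma compact_bound K : compact K ->
  exists2 r : R, 0 < r & forall z, K z -> `|z.1| < r /\ `|z.2| < r.
Proof.
move=> cK.
have [M [_ hM]] := compact_bounded cK.
have M0 : 0 < Num.max (M + 1) 1 by rewrite lt_max ltr01 orbT.
exists (Num.max (M + 1) 1 + 1); first lra.
move=> z Kz; have : `|z| <= Num.max (M + 1) 1.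
  by apply: hM => //; rewrite lt_max ltrDl ltr01.
rewrite prod_normE ge_max => /andP[h1 h2]; split; apply: le_lt_trans (h1) _ || apply: le_lt_trans (h2) _; lra.
Qed.

Lemma points_bound (I : finType) (a : I -> P) :
  exists2 r : R, 0 < r & forall i, `|(a i).1| < r /\ `|(a i).2| < r.
Proof.
exists (1 + \sum_i (`|(a i).1| + `|(a i).2|)).
  by rewrite ltr_pwDl // sumr_ge0 // => i _; rewrite addr_ge0.
move=> i; rewrite (bigD1 i) //=.
have : 0 <= \sum_(j | j != i) (`|(a j).1| + `|(a j).2|) by rewrite sumr_ge0 // => j _; rewrite addr_ge0.
by have := normr_ge0 (a i).1; have := normr_ge0 (a i).2; split; lra.
Qed.

Lemma square_compact (r : R) : compact ([set z | `|z.1| <= r /\ `|z.2| <= r] : set P).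
Proof.
have -> : [set z : P | `|z.1| <= r /\ `|z.2| <= r] = `[- r, r]%classic `*` `[- r, r]%classic.
  by apply/seteqP; split=> z /=; rewrite !in_itv /= !ler_norml.
by apply: compact_setX; exact: segment_compact.
Qed.

Lemma circle_square (r : R) z : 0 < r -> circle r z -> `|z.1| <= r /\ `|z.2| <= r.
Proof.
move=> r0 [t _ <-] /=; rewrite !normrM (gtr0_norm r0).
by split; rewrite ler_piMr ?(ltW r0) // ?cos_max ?sin_max.
Qed.

Lemma circle_far (r : R) z : 0 < r -> circle r z -> ~ (`|z.1| < r / 2 /\ `|z.2| < r / 2).
Proof.
move=> r0 [t _ <-] /=; rewrite !normrM (gtr0_norm r0) => -[h1 h2].
have [c1 s1] : `|cos t| < 1 / 2 /\ `|sin t| < 1 / 2.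
  by split; [move: h1|move: h2]; rewrite mulrC -ltr_pdivlMr // mulrAC divff ?gt_eqF.
have half (x : R) : `|x| < 1 / 2 -> x ^+ 2 < 4^-1.
  by move=> h; rewrite -real_normK ?num_real //; have := normr_ge0 x; nra.
by have := cos2Dsin2 t; have := half _ c1; have := half _ s1; lra.
Qed.

(** A circle around everything: up to a lift all the [ang (a i)] coincide on it with [ang 0], so
    winding numbers of functions on the whole plane can be tested there. *)
Lemma big_circle K (I : finType) (a : I -> P) : compact K ->
  exists r : R, [/\ 0 < r, forall z, circle r z -> ~ K z &
     forall i, clift (circle r) (fun z => ang (a i) z - ang 0 z)].
Proof.
move=> /compact_bound [r1 r10 h1]; have [r2 r20 h2] := points_bound a.
have r0 : 0 < 2 * (r1 + r2) by lra.
exists (2 * (r1 + r2)); split => //.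
  move=> z /(circle_far r0) h Kz; apply: h; have [] := h1 _ Kz; split; lra.
by move=> i; apply: circle_ang => //; have [] := h2 i; lra.
Qed.

Lemma circle_plane_lift (r : R) (al : P -> R) : 0 < r -> ccont setT al -> clift (circle r) al.
Proof.
move=> r0 h; apply: cliftW _ (plane_lift (@square_compact r) h).
by move=> z; exact: circle_square.
Qed.

(** With [g] a Tietze extension of the lift, the function [be] is [g] minus the terms other than
    [i0] on [U], and the term of [i0] elsewhere. The two formulas agree on [K] modulo 2 pi, so [be]
    lifts on a large circle. If the circle is outside [U], it sees the winding number [n i0]; if it
    is inside, it sees the sum of the other coefficients, which is [- n i0]. *)
Lemma lift_indep K U (I : finType) (a : I -> P) (n : I -> int) i0 :
  compact K -> open U -> (forall z, U z -> ~ K z) -> closure U `<=` U `|` K ->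
  U (a i0) -> (forall i, i != i0 -> ~ U (a i)) -> (forall i, ~ K (a i)) ->
  \sum_i n i = 0 -> clift K (fun z => \sum_i (n i)%:~R * ang (a i) z) ->
  n i0 = 0.
Proof.
move=> cK oU UK cU Ua Una Ka n0 [th cth hth].
have clK : closed K by apply: compact_closed => //; exact: prod_hausdorff.
have [g cg gE] := tietze cK cth.
pose rest z := \sum_(i | i != i0) (n i)%:~R * ang (a i) z.
pose be z := if pselect (U z) then g z - rest z else (n i0)%:~R * ang (a i0) z.
have clA : closed (U `|` K).
  have -> : U `|` K = closure U `|` K.
    apply/seteqP; split=> z; case; [by left; exact: subset_closure|by right| |by right].
    exact: cU.
  by apply: closedU => //; exact: closed_closure.
have clB : closed (~` U) by exact: open_closedC.
have cgT A : {within A, continuous g} by exact: continuous_subspaceT.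
have cbe : ccont setT be.
  have -> : setT = (U `|` K) `|` ~` U.
    by apply/seteqP; split=> z // _; have [?|?] := pselect (U z); [left; left|right].
  apply: ccontU => //.
    apply: (@ccont_eqm _ _ _ (fun z => g z - rest z)).
      move=> z zUK; rewrite /be; case: pselect => Uz; first exact: eqm_refl.
      have Kz : K z by case: zUK.
      rewrite gE //; have := hth _ Kz; rewrite (bigD1 i0) //= -/(rest z) => h.
      by have := eqmD h (eqm_refl (- rest z)); rewrite addrK.
    apply: ccontD; first exact: wcont_ccont.
    apply: ccontN; rewrite /rest.
    apply: (@ccont_eqm _ _ _ (fun z => \sum_i (if i != i0 then n i else 0)%:~R * ang (a i) z)).
      move=> z _; rewrite [X in eqm _ X]big_mkcond /=.
      rewrite (eq_bigr (fun i => if i != i0 then (n i)%:~R * ang (a i) z else 0)); first exact: eqm_refl.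
      by move=> i _; case: ifP => //; rewrite mul0r.
    apply: ccont_sum => i; case: ifP => [ii0|_].
      by apply: ccontMz; apply: ccont_ang => -[]; [exact: Una|exact: Ka].
    by apply: (ccont_eqm _ (@ccont0 R _ _)) => z _; rewrite mul0r; exact: eqm_refl.
  apply: (@ccont_eqm _ _ _ (fun z => (n i0)%:~R * ang (a i0) z)).
    by move=> z Uz; rewrite /be; case: pselect => [/Uz//|?]; exact: eqm_refl.
  by apply: ccontMz; apply: ccont_ang => /(_ Ua).
have [r [r0 rK ra]] := big_circle a cK.
have hbe := circle_plane_lift r0 cbe.
have [inU|outU] := connected_side (@circle_connected R r) rK oU cU; last first.
  apply: (circle_nolift r0).
  apply: clift_eqm (cliftB hbe (cliftMz (n i0) (ra i0))) => z /outU Uz.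
  by rewrite /be; case: pselect => [/Uz//|?]; rewrite mulrBr subKr; exact: eqm_refl.
have hr : clift (circle r) (fun z => (- n i0)%:~R * ang 0 z).
  have h1 : clift (circle r) rest.
    apply: clift_eqm (cliftB (clift_wcont (cgT _)) hbe) => z /inU Uz.
    by rewrite /be; case: pselect => [?|/(_ Uz)//]; rewrite subKr; exact: eqm_refl.
  have h2 : clift (circle r) (fun z => \sum_i (if i != i0 then n i else 0)%:~R * (ang (a i) z - ang 0 z)).
    by apply: clift_sum => i; apply: cliftMz.
  apply: clift_eqm (cliftB h1 h2) => z _; rewrite /rest.
  rewrite [X in X - _]big_mkcond /= -sumrB.
  rewrite (eq_bigr (fun i => (if i != i0 then n i else 0)%:~R * ang 0 z)); last first.
    by move=> i _; case: ifP => _; [rewrite mulrBr subKr|rewrite !mul0r subr0].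
  rewrite -mulr_suml -(rmorph_sum (intmul 1)) /= -big_mkcond /=.
  have -> : \sum_(i | i != i0) n i = - n i0; last exact: eqm_refl.
  by move: n0; rewrite (bigD1 i0) //= => /eqP; rewrite addrC addr_eq0 => /eqP.
have := circle_nolift r0 hr; lia.
Qed.

End PlaneSeparation.

(** * Extending circle-valued functions over faces *)

Section FaceExtension.
Variables (R : realType) (K : set (R * R)) (N : nat).
Variables (U C : 'I_N -> set (R * R)).
Hypotheses (cK : compact K) (oU : forall i, open (U i)) (UK : forall i z, U i z -> ~ K z).
Hypotheses (cC : forall i, compact (C i)) (CK : forall i, C i `<=` K).
Hypotheses (cU : forall i, closure (U i) `<=` U i `|` C i).
Hypothesis Udisj : forall i j z, U i z -> U j z -> i = j.
Hypothesis cover : forall z, K z \/ exists i, U i z.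

Let clK : closed K.
Proof. by apply: compact_closed => //; exact: prod_hausdorff. Qed.

Let clUC i : closed (U i `|` C i).
Proof.
have -> : U i `|` C i = closure (U i) `|` C i.
  apply/seteqP; split=> z; case; [by left; exact: subset_closure|by right| |by right].
  exact: cU.
apply: closedU; first exact: closed_closure.
by apply: compact_closed => //; exact: prod_hausdorff.
Qed.

Let cUK i : closure (U i) `<=` U i `|` K.
Proof. by move=> z /cU [|/CK]; [left|right]. Qed.

(** On each face in [J] the value is a Tietze extension of a lift on the boundary. It agrees with
    [al] on the boundary modulo 2 pi, so the pieces glue. *)
Lemma extend_to_faces (J : pred 'I_N) (al : R * R -> R) :
  ccont K al -> (forall i, J i -> clift (C i) al) ->
  exists al', [/\ forall z, K z -> al' z = al z,
     forall i, J i -> exists2 g, continuous g & forall z, U i z -> al' z = g z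
   & ccont [set z | K z \/ exists2 i, J i & U i z] al'].
Proof.
move=> cal hJ.
have /choice [g hg] : forall i, exists g : R * R -> R,
    J i -> continuous g /\ forall z, C i z -> eqm (g z) (al z).
  move=> i; case: (boolP (J i)) => Ji; last by exists (fun=> 0).
  have [th cth hth] := hJ i Ji; have [g cg gE] := tietze (@cC i) cth.
  by exists g => _; split => // z Cz; rewrite gE //; exact: hth.
pose al' z := if pselect (K z) then al z else
  if pselect (exists i, U i z) is left e then g (projT1 (cid e)) z else 0.
have a1 z : K z -> al' z = al z by rewrite /al'; case: pselect.
have a2 i z : U i z -> al' z = g i z.
  move=> Uz; rewrite /al'; case: pselect => [/(UK Uz)//|nK].
  case: pselect => [e|[]]; last by exists i.
  by rewrite (Udisj (projT2 (cid e)) Uz).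
exists al'; split => //.
  by move=> i Ji; exists (g i); [case: (hg i Ji)|exact: a2].
pose A (o : option 'I_N) := if o is Some i then if J i then U i `|` C i else set0 else K.
have -> : [set z | K z \/ exists2 i, J i & U i z] = [set z | exists o, A o z].
  apply/seteqP; split=> z.
    case=> [Kz|[i Ji Uz]]; first by exists None.
    by exists (Some i); rewrite /A Ji; left.
  case=> -[i|]; rewrite /A; last by left.
  by case: ifP => // Ji [Uz|/CK Kz]; [right; exists i|left].
apply: ccont_glue => -[i|] //=.
- by case: ifP => // _; exact: closed0.
- case: ifP => Ji; last by split; exact: continuous_subspace0.
  have [cg gC] := hg i Ji.
  apply: (@ccont_eqm _ _ _ (g i)).
    move=> z [Uz|Cz]; first by rewrite (a2 i z Uz); exact: eqm_refl.
    by rewrite a1; [exact: gC|exact: CK Cz].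
  by apply: wcont_ccont; exact: continuous_subspaceT.
- by apply: ccont_eqm cal => z /a1 ->; exact: eqm_refl.
Qed.

(** Extended over every face, the function is continuous on the whole plane and therefore lifts on
    compact sets. *)
Lemma lift_of_face_lifts (al : R * R -> R) :
  ccont K al -> (forall i, clift (C i) al) -> clift K al.
Proof.
move=> cal h; have [al' [a1 _]] := @extend_to_faces predT al cal (fun i _ => h i).
have -> : [set z | K z \/ exists2 i, predT i & U i z] = setT.
  by apply/seteqP; split => // z _; have [|[i Uz]] := cover z; [left|right; exists i].
move=> /(plane_lift cK) h2; apply: clift_eqm h2 => z /a1 ->; exact: eqm_refl.
Qed.

(* An extension of [al] over all faces but one has, along the boundary of the
   remaining face, winding number 0, because it also extends over infinity. *)
Lemma lift_missing_face (al : R * R -> R) (i1 : 'I_N) (a b : R * R) (k m : int) :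
  ccont K al -> (forall i, i != i1 -> clift (C i) al) ->
  U i1 a -> ~ U i1 b -> ~ K b ->
  clift (C i1) (fun z => k%:~R * al z - m%:~R * (ang a z - ang b z)) -> m = 0.
Proof.
move=> cal h Ua Ub Kb hC.
have [al' [a1 a2 cal']] := @extend_to_faces (fun i => i != i1) al cal h.
have [th cth hth] := hC; have [g cg gE] := tietze (@cC i1) cth.
(* The hypothesis on [C i1] makes the two formulas agree there modulo 2 pi. Each is continuous as a
   circle-valued function where it is used, since [b] is off the closure of the face and [a] is
   inside the face. *)
pose be z := if pselect (U i1 z) then g z - m%:~R * ang b z
             else k%:~R * al' z - m%:~R * ang a z.
have be1 z : U i1 z -> be z = g z - m%:~R * ang b z.
  by rewrite /be; case: pselect.
have be2 z : ~ U i1 z -> be z = k%:~R * al' z - m%:~R * ang a z.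
  by rewrite /be; case: pselect.
have cgT A : {within A, continuous g} by exact: continuous_subspaceT.
have cbe : ccont setT be.
  have -> : setT = (U i1 `|` C i1) `|` ~` U i1.
    by apply/seteqP; split=> z // _; have [?|?] := pselect (U i1 z); [left; left|right].
  apply: ccontU => //; first exact: open_closedC.
    apply: (@ccont_eqm _ _ _ (fun z => g z - m%:~R * ang b z)).
      move=> z zUC; have [Uz|Uz] := pselect (U i1 z).
        by rewrite be1 //; exact: eqm_refl.
      have Cz : C i1 z by case: zUC.
      rewrite be2 // gE // (a1 z (CK Cz)).
      have := eqmD (hth _ Cz) (eqm_refl (- (m%:~R * ang b z))).
      by congr (eqm _ _); ring.
    apply: ccontD; first exact: wcont_ccont.
    by apply: ccontN; apply: ccontMz; apply: ccont_ang => -[//|/CK].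
  apply: (@ccont_eqm _ _ _ (fun z => k%:~R * al' z - m%:~R * ang a z)).
    by move=> z Uz; rewrite be2 //; exact: eqm_refl.
  apply: ccontD.
    apply: ccontMz; apply: ccontW cal' => z Uz.
    have [Kz|[i Ui]] := cover z; [by left|right; exists i => //].
    by apply/eqP => e; apply: Uz; rewrite -e.
  by apply: ccontN; apply: ccontMz; apply: ccont_ang => /(_ Ua).
have [r [r0 rK ra]] := big_circle (fun b0 : bool => if b0 then a else b) cK.
have hbe := circle_plane_lift r0 cbe.
have [i rU] : exists i, forall z, circle r z -> U i z.
  have c0 : circle r (circ r 0) by exists 0.
  have [/(rK _ c0)//|[i Ui]] := cover (circ r 0).
  by exists i; have [//|/(_ _ c0)//] := connected_side (@circle_connected R r) rK (@oU i) (@cUK i).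
apply: (circle_nolift r0).
(* The large circle lies in one face. Up to a lift, [be] is there [- m * ang b] if this is the
   missing face and [- m * ang a] otherwise; both have winding number [- m]. *)
have [e|ne] := eqVneq i i1.
  have h1 : clift (circle r) (fun z => m%:~R * ang b z).
    apply: clift_eqm (cliftB (clift_wcont (cgT _)) hbe) => z /rU Uz.
    by rewrite be1 -?e // subKr; exact: eqm_refl.
  apply: clift_eqm (cliftB h1 (cliftMz m (ra false))) => z _.
  by rewrite mulrBr subKr; exact: eqm_refl.
have [gi cgi giE] := a2 i ne.
have h1 : clift (circle r) (fun z => m%:~R * ang a z).
  have cgi' : clift (circle r) (fun z => k%:~R * gi z).
    by apply: cliftMz; apply: clift_wcont; exact: continuous_subspaceT.
  apply: clift_eqm (cliftB cgi' hbe) => z /rU Uz.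
  rewrite be2 ?giE // ?subKr; first exact: eqm_refl.
  by move=> U1; move/eqP: ne; apply; exact: Udisj Uz U1.
apply: clift_eqm (cliftB h1 (cliftMz m (ra true))) => z _.
by rewrite mulrBr subKr; exact: eqm_refl.
Qed.

End FaceExtension.

(** * Winding numbers along the edges of a drawing *)

Lemma compact_finite_union (T : topologicalType) (I : finType) (A : I -> set T) :
  (forall i, compact (A i)) -> compact [set z | exists i, A i z].
Proof.
move=> cA; have -> : [set z | exists i, A i z] = \big[setU/set0]_(i <- enum I) A i.
  rewrite -bigcup_seq; apply/seteqP; split=> z.
    by case=> i Az; exists i => //=; rewrite mem_enum.
  by case=> i _ Az; exists i.
by apply: bigsetU_compact.
Qed.

Section DrawingClasses.
Variables (R : realType) (G : graph) (D : plane_drawing R G).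
Implicit Types (al : R * R -> R) (y : G -> G -> int) (l : G -> R) (x : G -> int).
Local Notation pos := (pos D).
Local Notation earc := (earc D).
Local Notation K := (drawing_support D).

Lemma adjC (u v : G) : adj u v = adj v u.
Proof. exact: adj_sym. Qed.

Lemma adj_neq (u v : G) : adj u v -> u != v.
Proof. by move=> uv; apply/eqP => e; rewrite e adj_irr in uv. Qed.

Lemma earc_pos u v : adj u v -> earc u v (pos u) /\ earc u v (pos v).
Proof. by move=> uv; exact: (arc_ends (earc_arc D uv)). Qed.

Lemma earc_closed u v : adj u v -> closed (earc u v).
Proof. by move=> uv; exact: (arc_closed (earc_arc D uv)). Qed.

Lemma earc_compact u v : adj u v -> compact (earc u v).
Proof. by move=> uv; exact: (arc_compact (earc_arc D uv)). Qed.

Lemma earc_connected u v : adj u v -> connected (earc u v).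
Proof. by move=> uv; exact: (arc_connected (earc_arc D uv)). Qed.

Lemma earc_support u v : adj u v -> earc u v `<=` K.
Proof. by move=> uv z uvz; right; exists u, v. Qed.

Lemma earc_meet u v u' v' z : adj u v -> adj u' v' -> earc u v z -> earc u' v' z ->
  [\/ (u = u' /\ v = v'), (u = v' /\ v = u')
    | exists w, [/\ z = pos w, w = u \/ w = v & w = u' \/ w = v']].
Proof.
move=> uv u'v' h h'.
have [e|ne] := eqVneq [set u; v]%SET [set u'; v']%SET; last first.
  have [w zw] := earc_disjoint uv u'v' ne h h'.
  by apply: Or33; exists w; rewrite zw in h h'; split => //;
     [exact: (earc_vertex uv h)|exact: (earc_vertex u'v' h')].
have n := adj_neq uv; have n' := adj_neq u'v'.
have : u \in [set u'; v']%SET by rewrite -e set21.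
have : v \in [set u'; v']%SET by rewrite -e set22.
rewrite !inE => /orP[] /eqP ev /orP[] /eqP eu.
- by rewrite ev eu eqxx in n.
- by apply: Or32.
- by apply: Or31.
- by rewrite ev eu eqxx in n.
Qed.

(** All vertices are kept, as in a spanning subgraph. [H] may contain an edge in one orientation
    only, as for an oriented cycle. *)
Definition sub_support (H : rel G) : set (R * R) :=
  [set z | (exists v, z = pos v) \/ exists u v, H u v /\ earc u v z].

Definition sub_piece (H : rel G) (i : G + G * G) : set (R * R) :=
  match i with
  | inl v => [set pos v]
  | inr p => if H p.1 p.2 then earc p.1 p.2 else set0
  end.

Lemma sub_supportE H : sub_support H = [set z | exists i, sub_piece H i z].
Proof.
apply/seteqP; split=> z.
  case=> [[v ->]|[u [v [uv h]]]]; first by exists (inl v).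
  by exists (inr (u, v)); rewrite /sub_piece /= uv.
case=> -[v|[u v]] /=; first by move=> ->; left; exists v.
by case: ifP => // uv h; right; exists u, v.
Qed.

Lemma sub_piece_compact (H : rel G) i : subrel H (@adj G) -> compact (sub_piece H i).
Proof.
move=> HG; case: i => [v|[u v]] /=; first exact: compact_set1.
by case: ifP => [/HG /earc_compact//|_]; exact: compact0.
Qed.

Lemma sub_piece_closed (H : rel G) i : subrel H (@adj G) -> closed (sub_piece H i).
Proof.
move=> HG; apply: compact_closed; first exact: prod_hausdorff.
exact: sub_piece_compact.
Qed.

Lemma sub_support_compact (H : rel G) : subrel H (@adj G) -> compact (sub_support H).
Proof.
by move=> HG; rewrite sub_supportE; apply: compact_finite_union => i; exact: sub_piece_compact.
Qed.

Lemma support_compact : compact K.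
Proof. exact: (@sub_support_compact (@adj G)). Qed.

Lemma sub_supportS (H : rel G) : subrel H (@adj G) -> sub_support H `<=` K.
Proof. by move=> HG z [|[u [v [/HG uv h]]]]; [left|right; exists u, v]. Qed.

(* [y u v] is the winding, in full turns, of [al] along the edge from [u] to
   [v], relative to a choice [l] of the values of [al] at the vertices. *)
Definition edge_class al y := exists l,
  (forall v, eqm (l v) (al (pos v))) /\
  forall u v, adj u v -> exists th : R * R -> R,
    [/\ {within earc u v, continuous th}, forall z, earc u v z -> eqm (th z) (al z),
        th (pos u) = l u & th (pos v) = l v + (y u v)%:~R * (2 * pi)].

(** The lift on each arc is shifted to start at the value of [al] at the first vertex; at the other
    end the discrepancy is a whole number of turns. *)
Lemma edge_class_exists al : ccont K al -> exists y, edge_class al y.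
Proof.
move=> cal.
have h (p : G * G) : exists k : int, adj p.1 p.2 -> exists th : R * R -> R,
    [/\ {within earc p.1 p.2, continuous th}, forall z, earc p.1 p.2 z -> eqm (th z) (al z),
        th (pos p.1) = al (pos p.1) & th (pos p.2) = al (pos p.2) + k%:~R * (2 * pi)].
  case: p => u v /=; case: (boolP (adj u v)) => uv; last by exists 0.
  have [th cth hth] := arc_lift (earc_arc D uv) (ccontW (earc_support uv) cal).
  have [hu hv] := earc_pos uv.
  have eu := eqm_sym (hth _ hu).
  pose th' z := th z + (al (pos u) - th (pos u)).
  have hth' z : earc u v z -> eqm (th' z) (al z).
    move=> /hth e; have := eqmD e (eqmD eu (eqm_refl (- th (pos u)))).
    by rewrite subrr addr0.
  have [k ek] := hth' _ hv.
  exists k => _; exists th'; split => //.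
    by apply: wcontD => //; exact: wcont_cst.
  by rewrite /th' addrC subrK.
have [k hk] := choice h.
exists (fun u v => k (u, v)), (fun v => al (pos v)); split; first by move=> v; exact: eqm_refl.
by move=> u v uv; exact: (hk (u, v) uv).
Qed.

Lemma edge_classD al be y y' : edge_class al y -> edge_class be y' ->
  edge_class (fun z => al z + be z) (fun u v => y u v + y' u v).
Proof.
move=> [l [hl h]] [l' [hl' h']]; exists (fun v => l v + l' v); split.
  by move=> v; exact: eqmD.
move=> u v uv; have [th [c1 e1 u1 v1]] := h u v uv; have [th' [c2 e2 u2 v2]] := h' u v uv.
exists (fun z => th z + th' z); split.
- exact: wcontD.
- by move=> z hz; apply: eqmD; [exact: e1|exact: e2].
- by rewrite u1 u2.
- by rewrite v1 v2 intrD; ring.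
Qed.

Lemma edge_classMz al y (n : int) : edge_class al y ->
  edge_class (fun z => n%:~R * al z) (fun u v => n * y u v).
Proof.
move=> [l [hl h]]; exists (fun v => n%:~R * l v); split.
  by move=> v; exact: eqmMz.
move=> u v uv; have [th [c1 e1 u1 v1]] := h u v uv.
exists (fun z => n%:~R * th z); split.
- by apply: wcontM => //; exact: wcont_cst.
- by move=> z hz; apply: eqmMz; exact: e1.
- by rewrite u1.
- by rewrite v1 intrM; ring.
Qed.

Lemma edge_class_eq al be y y' : edge_class al y -> al =1 be -> (forall u v, y u v = y' u v) ->
  edge_class be y'.
Proof.
move=> [l [hl h]] e ey; exists l; split=> [v|u v uv]; first by rewrite -e.
have [th [c1 e1 u1 v1]] := h u v uv; exists th; split => //; last by rewrite -ey.
by move=> z /e1; rewrite e.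
Qed.

Lemma edge_class_sum (I : Type) (r : seq I) (n : I -> int) (al : I -> R * R -> R) (y : I -> G -> G -> int) :
  (forall i, edge_class (al i) (y i)) ->
  edge_class (fun z => \sum_(i <- r) (n i)%:~R * al i z) (fun u v => \sum_(i <- r) n i * y i u v).
Proof.
move=> h; elim: r => [|i r ih].
  exists (fun=> 0); split.
    by move=> v; rewrite big_nil; exact: eqm_refl.
  move=> u v uv; exists (fun=> 0); split => //.
  - exact: wcont_cst.
  - by move=> z _; rewrite big_nil; exact: eqm_refl.
  - by rewrite big_nil mul0r addr0.
apply: edge_class_eq (edge_classD (edge_classMz (n i) (h i)) ih) _ _.
  by move=> z; rewrite big_cons.
by move=> u v; rewrite big_cons.
Qed.

Lemma pi2_gt0 : 0 < 2 * pi :> R.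
Proof. by have := pi_gt0 R; lra. Qed.

Lemma int_pi_inj (m n : int) : m%:~R * (2 * pi) = n%:~R * (2 * pi) :> R -> m = n.
Proof. by move=> /(mulIf (lt0r_neq0 pi2_gt0)) /intr_inj. Qed.

Lemma edge_class_anti al y u v : edge_class al y -> adj u v -> y v u = - y u v.
Proof.
move=> [l [hl h]] uv; have vu : adj v u by rewrite adjC.
have [th [c1 e1 u1 v1]] := h u v uv; have [th' [c2 e2 u2 v2]] := h v u vu.
rewrite -(earc_sym D uv) in c2 e2.
have e z : earc u v z -> eqm (th z) (th' z).
  by move=> hz; exact: eqm_trans (e1 _ hz) (eqm_sym (e2 _ hz)).
have [hu hv] := earc_pos uv.
have := lift_unique (earc_connected uv) c1 c2 e hu hv.
rewrite u1 v1 u2 v2 => k; apply: int_pi_inj; rewrite mulrNz; lra.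
Qed.

(** Shifting the value at each vertex [v] by [x v] turns absorbs the windings along the edges of
    [H], so the lifts on the arcs agree at common vertices and glue. *)
Lemma edge_class_lift al y (H : rel G) x : edge_class al y -> subrel H (@adj G) ->
  (forall u v, H u v -> y u v = x v - x u) -> clift (sub_support H) al.
Proof.
move=> [l [hl h]] HG hx.
have /choice [th hth] : forall p : G * G, exists th : R * R -> R, H p.1 p.2 ->
    [/\ {within earc p.1 p.2, continuous th}, forall z, earc p.1 p.2 z -> eqm (th z) (al z),
        th (pos p.1) = l p.1 & th (pos p.2) = l p.2 + (y p.1 p.2)%:~R * (2 * pi)].
  case=> u v /=; case: (boolP (H u v)) => [uv|]; last by exists (fun=> 0).
  by have [th ?] := h u v (HG _ _ uv); exists th.
pose L v := l v + (x v)%:~R * (2 * pi).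
pose t (i : G + G * G) : R * R -> R :=
  match i with
  | inl v => fun=> L v
  | inr p => fun z => th p z + (x p.1)%:~R * (2 * pi)
  end.
have tV i w : sub_piece H i (pos w) -> t i (pos w) = L w.
  case: i => [v|[u v]] /=; first by move=> /(pos_inj) ->.
  case: ifP => // uv hw; have [_ _ /= eu ev] := hth (u, v) uv.
  have [->|->] := earc_vertex (HG _ _ uv) hw; first by rewrite eu.
  by rewrite ev (hx _ _ uv) intrB /L; ring.
rewrite sub_supportE; apply: (@clift_glue _ _ _ (sub_piece H) t).
- by move=> i; exact: sub_piece_closed.
- case=> [v|[u v]] /=; first exact: wcont_cst.
  case: ifP => [uv|_]; last exact: continuous_subspace0.
  have [c _ _ _] := hth (u, v) uv.
  by apply: wcontD => //; exact: wcont_cst.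
- move=> i j z hi hj.
  have [[w zw]|nv] := pselect (exists w, z = pos w).
    by rewrite zw in hi hj *; rewrite !tV.
  case: i hi => [v /= zv|[u v] hi]; first by case: nv; exists v.
  case: j hj => [v' /= zv|[u' v'] hj]; first by case: nv; exists v'.
  have hi' := hi; have hj' := hj; move: hi' hj' => /=.
  case: ifP => // uv h1; case: ifP => // uv' h2.
  have [[-> ->]//|[eu ev]|[w [zw _ _]]] := earc_meet (HG _ _ uv) (HG _ _ uv') h1 h2; last first.
    by case: nv; exists w.
  (* The remaining overlap is one arc listed in both orientations; the two lifts agree at an end,
     hence along the arc. *)
  subst u' v'.
  have [c1 e1 /= _ _] := hth (u, v) uv; have [c2 e2 /= _ _] := hth (v, u) uv'.
  have auv := HG _ _ uv.
  rewrite /= -(earc_sym D auv) in c2 e2.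
  have cc1 : {within earc u v, continuous (t (inr (u, v)))}.
    by apply: wcontD => //; exact: wcont_cst.
  have cc2 : {within earc u v, continuous (t (inr (v, u)))}.
    by apply: wcontD => //; exact: wcont_cst.
  have ee w : earc u v w -> eqm (t (inr (u, v)) w) (t (inr (v, u)) w).
    move=> hw; rewrite /t; apply: eqm_trans (eqm_int _ _) _; apply: eqm_sym.
    apply: eqm_trans (eqm_int _ _) _; exact: eqm_trans (e2 _ hw) (eqm_sym (e1 _ hw)).
  have [hu hv] := earc_pos auv.
  have := lift_unique (earc_connected auv) cc1 cc2 ee hu h1.
  have p1 : sub_piece H (inr (u, v)) (pos u) by rewrite /= uv.
  have p2 : sub_piece H (inr (v, u)) (pos u) by rewrite /= uv' -(earc_sym D auv).
  rewrite (tV _ _ p1) (tV _ _ p2).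
  by move=> /addIr.
- case=> [v|[u v]] z /=.
    by move=> ->; exact: eqm_trans (eqm_int _ _) (hl v).
  case: ifP => // uv hz; have [_ e1 _ _] := hth (u, v) uv.
  by apply: eqm_trans (eqm_int _ _) _; exact: e1.
Qed.

(** [x v] is the number of turns by which the lift differs from [l v]; uniqueness of lifts along an
    arc then computes [y]. *)
Lemma edge_class_unlift al y (B : set (R * R)) : edge_class al y -> clift B al ->
  exists x, forall u v, adj u v -> earc u v `<=` B -> y u v = x v - x u.
Proof.
move=> [l [hl h]] [t ct ht].
have /choice [x hx] : forall v, exists k : int, B (pos v) -> t (pos v) = l v + k%:~R * (2 * pi).
  move=> v; have [Bv|Bv] := pselect (B (pos v)); last by exists 0.
  by have [k ek] := eqm_trans (ht _ Bv) (eqm_sym (hl v)); exists k.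
exists x => u v uv uvB.
have [th [c1 e1 u1 v1]] := h u v uv.
have [hu hv] := earc_pos uv.
have e z : earc u v z -> eqm (th z) (t z).
  by move=> hz; exact: eqm_trans (e1 _ hz) (eqm_sym (ht _ (uvB _ hz))).
have := lift_unique (earc_connected uv) c1 (continuous_subspaceW uvB ct) e hu hv.
rewrite u1 v1 (hx _ (uvB _ hu)) (hx _ (uvB _ hv)) => k.
apply: int_pi_inj; rewrite intrB; lra.
Qed.

(** An arbitrary linear order of the vertices, which selects one orientation of each edge. *)
Definition upward (u v : G) := (enum_rank u < enum_rank v)%N.

Lemma upward_total u v : u != v -> upward u v = ~~ upward v u.
Proof.
move=> uv; rewrite /upward -leqNgt ltn_neqAle.
have -> // : (enum_rank u != enum_rank v :> nat).
by apply/eqP => /val_inj /enum_rank_inj e; rewrite e eqxx in uv.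
Qed.

(** The function makes [y u v] full turns along each arc, at constant speed in the parameter [h],
    and is 0 modulo 2 pi at all vertices. *)
Lemma edge_class_realize y : (forall u v, adj u v -> y v u = - y u v) ->
  exists2 al, ccont K al & edge_class al y.
Proof.
move=> anti.
have /choice [h hh] : forall p : G * G, exists h : R * R -> R, adj p.1 p.2 ->
    [/\ {within earc p.1 p.2, continuous h}, h (pos p.1) = 0 & h (pos p.2) = 1].
  case=> u v /=; case: (boolP (adj u v)) => [uv|]; last by exists (fun=> 0).
  by have [k ?] := arc_param (earc_arc D uv); exists k.
pose th u v z := h (u, v) z * ((y u v)%:~R * (2 * pi)).
have thV u v w : adj u v -> earc u v (pos w) -> eqm (th u v (pos w)) 0.
  move=> uv hw; have [_ /= h0 h1] := hh (u, v) uv; rewrite /th.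
  have [->|->] := earc_vertex uv hw; rewrite ?h0 ?h1 ?mul0r; first exact: eqm_refl.
  by rewrite mul1r; exists (y u v); rewrite add0r.
pose on z (p : G * G) := [/\ adj p.1 p.2, upward p.1 p.2 & earc p.1 p.2 z].
(* At a vertex several edges may qualify, but each [th] is a multiple of 2 pi there. *)
pose al z := if pselect (exists p, on z p) is left e
  then th (projT1 (cid e)).1 (projT1 (cid e)).2 z else 0.
have alE u v z : adj u v -> upward u v -> earc u v z -> eqm (th u v z) (al z).
  move=> uv up hz; rewrite /al; case: pselect => [e|[]]; last by exists (u, v).
  case: (projT1 (cid e)) (projT2 (cid e)) => u' v' [/= uv' up' hz'].
  have [[-> ->]|[eu ev]|[w [zw _ _]]] := earc_meet uv uv' hz hz'.
  - exact: eqm_refl.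
  - by move: up; rewrite upward_total ?adj_neq // ev eu up'.
  - by rewrite zw in hz hz' *; apply: eqm_trans (thV _ _ _ uv hz) (eqm_sym (thV _ _ _ uv' hz')).
have alV w : eqm 0 (al (pos w)).
  rewrite /al; case: pselect => [e|_]; last exact: eqm_refl.
  by case: (projT1 (cid e)) (projT2 (cid e)) => u v [/= uv up hz]; exact: eqm_sym (thV _ _ _ uv hz).
have cth u v : adj u v -> {within earc u v, continuous (th u v)}.
  by move=> uv; have [c _ _] := hh (u, v) uv; apply: wcontM => //; exact: wcont_cst.
exists al.
  pose H : rel G := fun u v => adj u v && upward u v.
  have HG : subrel H (@adj G) by move=> u v /andP[].
  have -> : K = sub_support H.
    apply/seteqP; split; last exact: sub_supportS.
    move=> z [|[u [v [uv hz]]]]; first by left.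
    right; have [up|up] := boolP (upward u v).
      by exists u, v; rewrite /H uv up.
    exists v, u; rewrite /H adjC uv /=; split; last by rewrite -(earc_sym D uv).
    by rewrite upward_total // eq_sym adj_neq.
  rewrite sub_supportE; apply: ccont_glue.
    by move=> i; exact: sub_piece_closed.
  case=> [v|[u v]] /=; first by split; exact: continuous_subspace1.
  case: ifP => [/andP[uv up]|_]; last by split; exact: continuous_subspace0.
  apply: (@ccont_eqm _ _ _ (th u v)); first by move=> z; exact: alE.
  by apply: wcont_ccont; exact: cth.
exists (fun=> 0); split; first by move=> v; exact: alV.
move=> u v uv; have [_ /= h0 h1] := hh (u, v) uv.
have [up|up] := boolP (upward u v).
  exists (th u v); split; [exact: cth|by move=> z; exact: alE| |].
    by rewrite /th h0 mul0r.
  by rewrite /th h1 mul1r add0r.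
have vu : adj v u by rewrite adjC.
have up' : upward v u by rewrite upward_total // adj_neq.
have [_ /= k0 k1] := hh (v, u) vu.
exists (fun z => th v u z + (y u v)%:~R * (2 * pi)); rewrite (earc_sym D uv); split.
- by apply: wcontD; [exact: cth|exact: wcont_cst].
- by move=> z hz; apply: eqm_trans (eqm_int _ _) _; exact: alE.
- by rewrite /th k1 mul1r (anti v u vu) mulrNz; ring.
- by rewrite /th k0 mul0r.
Qed.

End DrawingClasses.

(** With more unknowns than equations there is a nonzero rational solution; multiplying by all
    denominators makes it integral. *)
Lemma int_system_solution (I J : finType) (A : J -> I -> int) : (#|J| < #|I|)%N ->
  exists n : I -> int, (exists i, n i != 0) /\ forall j, \sum_i A j i * n i = 0.
Proof.
move=> JI.
pose M : 'M[rat]_(#|I|, #|J|) := \matrix_(i, j) (A (enum_val j) (enum_val i))%:~R.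
have kn0 : kermx M != 0.
  rewrite -mxrank_eq0 mxrank_ker subn_eq0 -ltnNge.
  exact: leq_ltn_trans (rank_leq_col M) JI.
pose v := nz_row (kermx M).
have vn0 : v != 0 by rewrite nz_row_eq0.
have vM : v *m M = 0 by apply/sub_kermxP; exact: nz_row_sub.
pose q i : rat := v 0 (enum_rank i).
pose n i : int := numq (q i) * \prod_(j | j != i) denq (q j).
pose d : int := \prod_j denq (q j).
have nE i : (n i)%:~R = q i * d%:~R :> rat.
  rewrite [d](bigD1 i) //= /n !rmorphM /= mulrA; congr (_ * _).
  by rewrite -{2}(divq_num_den (q i)) divfK // intr_eq0 denq_eq0.
have d0 : d%:~R != 0 :> rat.
  by rewrite intr_eq0; apply/prodf_neq0 => j _; exact: denq_neq0.
exists n; split.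
  have [i vi] : exists i, v 0 i != 0.
    apply/existsP; apply: contraR vn0; rewrite negb_exists => /forallP h.
    by apply/eqP/rowP => i; rewrite mxE; have := h i; rewrite negbK => /eqP.
  exists (enum_val i); rewrite -(intr_eq0 rat) nE mulf_neq0 // /q enum_valK //.
move=> j; apply: (@intr_inj rat); rewrite rmorph_sum /= mulr0z.
have /rowP/(_ (enum_rank j)) := vM; rewrite !mxE => h.
transitivity ((\sum_i q i * (A j i)%:~R) * d%:~R).
  by rewrite mulr_suml; apply: eq_bigr => i _; rewrite intrM nE; ring.
suff -> : \sum_i q i * (A j i)%:~R = 0 by rewrite mul0r.
rewrite -[RHS]h (reindex (@enum_val I predT)) /=; last first.
  by exists enum_rank => i _; [exact: enum_valK|exact: enum_rankK].
by apply: eq_bigr => i _; rewrite !mxE enum_rankK /q enum_valK.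
Qed.

(** * Cyclic sequences and winding along cycles *)

Lemma perm_next (T : eqType) (c : seq T) : uniq c -> perm_eq (map (next c) c) c.
Proof.
move=> uc.
have inj : injective (next c) by exact: can_inj (prev_next uc).
have um : uniq (map (next c) c) by rewrite map_inj_uniq.
have sub : {subset map (next c) c <= c} by move=> _ /mapP[w wc ->]; rewrite mem_next.
apply: uniq_perm => //; apply: (uniq_min_size um sub _).2.
by rewrite size_map.
Qed.

Lemma next_index (T : eqType) (c : seq T) u : uniq c -> u \in c ->
  index (next c u) c = if (index u c).+1 == size c then 0 else (index u c).+1.
Proof.
move=> uc uinc; have iu : (index u c < size c)%N by rewrite index_mem.
rewrite next_nth uinc; case: c uc uinc iu => // a c uc uinc iu.
case: eqP => [/= [e]|/eqP ne].
  by rewrite /= nth_default ?eqxx // e.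
have lt : (index u (a :: c) < size c)%N.
  by move: iu ne; rewrite ltnS leq_eqVlt eqSS => /orP[->|].
by rewrite -[nth a c _]/(nth a (a :: c) (index u (a :: c)).+1) index_uniq.
Qed.

Section Winding.
Variables (R : realType) (G : graph) (D : plane_drawing R G).
Implicit Types (al : R * R -> R) (y : G -> G -> int) (c : seq G).

Definition winding y c : int := \sum_(v <- c) y v (next c v).

Lemma winding_coboundary c (x : G -> int) : uniq c ->
  winding (fun u v => x v - x u) c = 0.
Proof.
move=> uc; rewrite /winding big_split /= sumrN.
rewrite -(big_map (next c) xpredT x) /= (perm_big _ (perm_next uc)) /=.
by rewrite subrr.
Qed.

Lemma winding_eq y y' c : (forall v, v \in c -> y v (next c v) = y' v (next c v)) ->
  winding y c = winding y' c.
Proof. by move=> h; apply: eq_big_seq. Qed.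

(** The potential [x] is the partial sum of [y] along the cycle; it also fits the closing edge
    because the total is 0. *)
Lemma winding0 y c : uniq c -> winding y c = 0 ->
  exists x : G -> int, forall u, u \in c -> y u (next c u) = x (next c u) - x u.
Proof.
move=> uc w0.
exists (fun v => \sum_(w <- take (index v c) c) y w (next c w)) => u uinc.
have iu : (index u c < size c)%N by rewrite index_mem.
have tk : take (index u c).+1 c = rcons (take (index u c) c) u.
  by rewrite (take_nth u) // nth_index.
rewrite next_index //; case: eqP => [e|_].
  have := w0; rewrite /winding -{1}[c](@take_size) -e tk -cats1 big_cat big_seq1 take0 big_nil /=.
  by move=> h; rewrite sub0r; apply/eqP; rewrite -addr_eq0 addrC h.
by rewrite tk -cats1 big_cat big_seq1 /=; ring.
Qed.

Lemma is_cycle_uniq c : is_cycle c -> uniq c.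
Proof. by case/andP => _ /andP[]. Qed.

Lemma is_cycle_adj c v : is_cycle c -> v \in c -> adj v (next c v).
Proof. by case/andP => _ /andP[cc _]; exact: next_cycle. Qed.

Definition cycle_rel c : rel G := fun u v => (u \in c) && (v == next c u).

Lemma cycle_rel_sub c : is_cycle c -> subrel (cycle_rel c) (@adj G).
Proof. by move=> cc u v /andP[uc /eqP ->]; exact: is_cycle_adj. Qed.

Lemma cycle_supportS c : cycle_support D c `<=` sub_support D (cycle_rel c).
Proof. by move=> z [v vc hz]; right; exists v, (next c v); rewrite /cycle_rel vc eqxx. Qed.

Lemma cycle_support_sub c : is_cycle c -> cycle_support D c `<=` drawing_support D.
Proof.
by move=> cc z /cycle_supportS; apply: sub_supportS; exact: cycle_rel_sub.
Qed.

Lemma cycle_lift al y c : edge_class D al y -> is_cycle c -> winding y c = 0 ->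
  clift (cycle_support D c) al.
Proof.
move=> cl cc w0; have [x hx] := winding0 (is_cycle_uniq cc) w0.
apply: cliftW (@cycle_supportS c) _.
apply: (edge_class_lift cl (cycle_rel_sub cc)) => u v /andP[uc /eqP ->].
exact: hx.
Qed.

Lemma cycle_support_compact c : is_cycle c -> compact (cycle_support D c).
Proof.
move=> cc; have -> : cycle_support D c = [set z | exists v : G, (if v \in c then earc D v (next c v) else set0) z].
  apply/seteqP; split=> z; first by case=> v vc hz; exists v; rewrite vc.
  by case=> v; case: ifP => // vc hz; exists v.
apply: compact_finite_union => v; case: ifP => [vc|_]; last exact: compact0.
by apply: earc_compact; exact: is_cycle_adj.
Qed.

End Winding.

(** * Euler's formula *)

Lemma connected_between (T : topologicalType) (A B : set T) :
  connected A -> A `<=` B -> B `<=` closure A -> connected B.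
Proof.
move=> cA AB BA X [w0 Xw0] [V oV XV] [C cC XC].
have BC : B `<=` C.
  suff AX : A `<=` C.
    by move=> z /BA; move/closureS: AX; rewrite -(iffLR (closure_id C) cC); apply.
  have : A `&` X = A.
    apply: cA.
    - have [Bq Vq] : (B `&` V) w0 by rewrite -XV.
      have [w [Aw Ow]] := BA w0 Bq V (open_nbhs_nbhs (conj oV Vq)).
      by exists w; split => //; rewrite XV; split => //; exact: AB.
    - by exists V => //; rewrite XV setIA (setIidl AB).
    - by exists C => //; rewrite XC setIA (setIidl AB).
  by move=> e z Az; have [] : (A `&` X) z; [rewrite e|rewrite XC => _ []].
by rewrite XC; apply/setIidPl.
Qed.

(** * Consequences of 5-connectivity *)

Section GraphFacts.
Variable G : graph.
Hypothesis hconn : k_connected 5 G.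

Lemma five_lt_card : (5 < #|G|)%N.
Proof. by case/andP: hconn. Qed.

Lemma five_connected (S : {set G}) : (#|S| < 5)%N -> induces_connected (~: S)%SET.
Proof. by case/andP: hconn => _ /forallP/(_ S)/implyP. Qed.

Lemma connect_const (A : {set G}) (x : G -> int) : induces_connected A ->
  (forall u v, u \in A -> v \in A -> adj u v -> x u = x v) ->
  forall u v, u \in A -> v \in A -> x u = x v.
Proof.
move=> /'forall_in_forall_inP cA hx u v uA vA.
have /connectP [p pp ->] := cA u uA v vA.
elim: p u {uA vA} pp => //= w p ih u /andP[/and3P[uA wA uw]] pp.
by rewrite (hx u w) // ih.
Qed.

Lemma adj_const (x : G -> int) : (forall u v : G, adj u v -> x u = x v) -> forall u v, x u = x v.
Proof.
move=> h u v; have c0 : induces_connected (~: (finset.set0 : {set G}))%SET by apply: five_connected; rewrite cards0.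
by apply: (connect_const c0) => [? ? _ _||]; rewrite ?inE //; exact: h.
Qed.

(** There is a third vertex [w], and deleting [v] leaves [u] connected to it; the first step of a
    connecting path gives the neighbour. *)
Lemma other_neighbour (u v : G) : exists2 w, adj u w & w != v.
Proof.
apply/exists_inP; apply: contraT; rewrite negb_exists => /forallP h.
have [w] : exists w, w \notin [set u; v]%SET.
  apply/existsP; apply: contraT; rewrite negb_exists => /forallP k.
  have : (#|G| <= #|[set u; v]%SET|)%N by apply: subset_leq_card; apply/fintype.subsetP => w _; have := k w; rewrite negbK.
  rewrite cards2; have := five_lt_card; case: (_ != _) => /=; lia.
rewrite !inE negb_or => /andP[wu wv].
(* This set is empty when [v] equals [u], so [u] itself is never deleted. *)
have c0 : induces_connected (~: ([set v] :\ u))%SET.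
  by apply: five_connected; apply: leq_ltn_trans (subset_leq_card (subsetDl _ _)) _; rewrite cards1.
have uA : u \in (~: ([set v] :\ u))%SET by rewrite !inE eqxx.
have wA : w \in (~: ([set v] :\ u))%SET by rewrite !inE (negbTE wv) andbF.
have /connectP [[|a p] /= pp e] := (elimT 'forall_in_forall_inP c0) u uA w wA.
  by rewrite e eqxx in wu.
case/andP: pp => /and3P[_ aA ua] _; have := h a; rewrite ua /=.
rewrite negbK => /eqP av; subst a; move: aA; rewrite !inE eqxx andbT negbK => /eqP vu.
by rewrite vu adj_irr in ua.
Qed.

Definition edge_indicator (u v : G) : G -> G -> int := fun u' v' =>
  ((u' == u) && (v' == v))%:R - ((u' == v) && (v' == u))%:R.

Lemma edge_indicator_anti u v u' v' : edge_indicator u v v' u' = - edge_indicator u v u' v'.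
Proof. by rewrite /edge_indicator opprB [(v' == u) && _]andbC [(v' == v) && _]andbC. Qed.

(* No edge is a bridge. *)
Lemma edge_indicator_not_coboundary u v (x : G -> int) : adj u v ->
  ~ (forall u' v', adj u' v' -> edge_indicator u v u' v' = x v' - x u').
Proof.
move=> uv h; have nuv : u != v by apply/eqP => e; rewrite e adj_irr in uv.
(* The potential [x] is constant off [u], where the graph remains connected, and equal at [u] and
   [w]; but it would have to rise by 1 from [u] to [v]. *)
have [w uw wv] := other_neighbour u v.
have nuw : w != u by apply/eqP => e; rewrite e adj_irr in uw.
have := h _ _ uv; rewrite /edge_indicator !eqxx (negbTE nuv) /= subr0 => e1.
have := h _ _ uw; rewrite /edge_indicator !eqxx (negbTE nuv) (negbTE wv) /= subrr => e2.
have c1 : induces_connected (~: [set u])%SET by apply: five_connected; rewrite cards1.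
have e3 : x w = x v.
  apply: (connect_const c1) => [a b||]; rewrite ?inE // ?(eq_sym v) //.
  move=> au bu ab; have := h _ _ ab; rewrite /edge_indicator (negbTE au) (negbTE bu) andbF subrr => /eqP.
  by rewrite eq_sym subr_eq0 => /eqP.
by move: e1 e2; rewrite e3 => <-.
Qed.

End GraphFacts.

(** * Edges in their upward orientation *)

Section OrientedEdges.
Variable G : graph.

Definition oedge := {p : G * G | adj p.1 p.2 && upward p.1 p.2}.

Lemma card_oedge : #|{: oedge}| = #|edges G|.
Proof.
pose O := [set p : G * G | adj p.1 p.2 && upward p.1 p.2]%SET.
have -> : #|{: oedge}| = #|O| by rewrite card_sig cardsE.
have inj : {in O &, injective (fun p : G * G => [set p.1; p.2]%SET)}.
  move=> [u v] [u' v']; rewrite !inE /= => /andP[uv up] /andP[uv' up'] e.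
  have : u \in [set u'; v']%SET by rewrite -e set21.
  have : v \in [set u'; v']%SET by rewrite -e set22.
  have n : u != v by apply/eqP => e'; rewrite e' adj_irr in uv.
  rewrite !inE => /orP[] /eqP ev /orP[] /eqP eu; subst u v => //.
  - by rewrite eqxx in n.
  - by rewrite upward_total // up' in up.
  - by rewrite eqxx in n.
rewrite -(card_in_imset inj); congr #|pred_of_set _|; apply/setP => e; rewrite !inE.
apply/imsetP/existsP => [[[u v]]|[u /existsP[v /andP[uv /eqP ->]]]].
  by rewrite inE /= => /andP[uv _] ->; exists u; apply/existsP; exists v; rewrite uv eqxx.
have n : u != v by apply/eqP => e'; rewrite e' adj_irr in uv.
have [up|up] := boolP (upward u v).
  by exists (u, v); rewrite // inE /= uv.
exists (v, u); last by rewrite /= finset.setUC.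
by rewrite inE /= adj_sym uv upward_total // eq_sym.
Qed.

Lemma oedge_adj (e : oedge) : adj (val e).1 (val e).2.
Proof. by case: e => p /= /andP[]. Qed.

Lemma adj_oedge (P : G -> G -> Prop) : (forall u v, P u v -> P v u) ->
  (forall e : oedge, P (val e).1 (val e).2) -> forall u v, adj u v -> P u v.
Proof.
move=> Psym h u v uv.
have n : u != v by apply/eqP => e'; rewrite e' adj_irr in uv.
have [up|up] := boolP (upward u v).
  have ok : adj (u, v).1 (u, v).2 && upward (u, v).1 (u, v).2 by rewrite /= uv.
  exact: (h (exist _ (u, v) ok)).
have ok : adj (v, u).1 (v, u).2 && upward (v, u).1 (v, u).2.
  by rewrite /= adj_sym uv upward_total // eq_sym.
by apply: Psym; exact: (h (exist _ (v, u) ok)).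
Qed.

End OrientedEdges.

(** * Upper bound for the number of faces *)

Section FaceCountUpperBound.
Variables (R : realType) (G : graph) (D : plane_drawing R G).
Hypothesis hconn : k_connected 5 G.
Local Notation K := (drawing_support D).
Local Notation comp := (connected_component (~` K)).

(** A family of distinct faces, given by one point in each. *)
Definition face_points (I : Type) (a : I -> R * R) :=
  (forall i, ~ K (a i)) /\ forall i j, comp (a i) (a j) -> i = j.

Lemma support_closed : closed K.
Proof. by apply: compact_closed; [exact: prod_hausdorff|exact: support_compact]. Qed.

Lemma comp_self z : ~ K z -> comp z z.
Proof. exact: connected_component_refl. Qed.

Lemma comp_off z w : comp z w -> ~ K w.
Proof. exact: connected_component_sub. Qed.

Lemma face_points_indep (I : finType) (a : I -> R * R) (n : I -> int) :
  face_points a -> \sum_i n i = 0 ->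
  clift K (fun z => \sum_i (n i)%:~R * ang (a i) z) -> forall i, n i = 0.
Proof.
move=> [Ka ka] n0 h i.
apply: (@lift_indep R K (comp (a i)) I a n i) => //.
- exact: support_compact.
- by apply: component_open; exact: support_closed.
- by move=> z /comp_off.
- by apply: component_closure; exact: support_closed.
- exact: comp_self.
- by move=> j /eqP ji /ka e; apply: ji.
Qed.

Lemma edge_class_ang a : ~ K a -> exists y, edge_class D (ang a) y.
Proof. by move=> Ka; apply: edge_class_exists; exact: ccont_ang. Qed.

Lemma edge_class_clift al (y : G -> G -> int) x : edge_class D al y ->
  (forall u v, adj u v -> y u v = x v - x u) -> clift K al.
Proof. by move=> cl hx; exact: (@edge_class_lift R G D al y (@adj G) x cl (fun _ _ => id) hx). Qed.

(** Otherwise there are integers [m] on the faces and [x] on the vertices, not all 0, that solve the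
    system [A]. Then the sum of the [m k * ang (a k)] lifts on the drawing, so [m] vanishes by
    independence; hence [x] is constant, and 0 since it is 0 at [v0]. *)
Lemma card_face_points (I : finType) (a : I -> R * R) : face_points a ->
  (#|I| + #|G| <= #|edges G| + 2)%N.
Proof.
move=> fa; rewrite leqNgt; apply/negP => lt.
have /card_gt0P [v0 _] : (0 < #|G|)%N by apply: leq_trans (five_lt_card hconn).
have /choice [y hy] := fun i => edge_class_ang (fa.1 i).
(* One equation per edge says that the combined class is the coboundary of [x]; the two others
   normalize, by asking that [m] sum to 0 and that [x] vanish at [v0]. *)
pose A (j : oedge G + bool) (i : I + G) : int :=
  match j, i with
  | inl e, inl k => y k (val e).1 (val e).2
  | inl e, inr v => ((val e).1 == v)%:R - ((val e).2 == v)%:R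
  | inr true, inl k => 1
  | inr true, inr v => 0
  | inr false, inl k => 0
  | inr false, inr v => (v0 == v)%:R
  end.
have [|n [[i0 ni0] hn]] := @int_system_solution (I + G)%type (oedge G + bool)%type A.
  by rewrite !card_sum card_bool card_oedge.
pose m k := n (inl k); pose x v := n (inr v).
have delta (v : G) : \sum_w ((v == w)%:R : int) * x w = x v.
  rewrite (bigD1 v) //= eqxx mul1r big1 ?addr0 // => w wv.
  by rewrite eq_sym (negbTE wv) mul0r.
have eqe (e : oedge G) : \sum_k m k * y k (val e).1 (val e).2 = x (val e).2 - x (val e).1.
  have := hn (inl e); rewrite big_sumType /= => h.
  have e2 : \sum_w (((val e).1 == w)%:R - ((val e).2 == w)%:R : int) * n (inr w) = x (val e).1 - x (val e).2.
    rewrite -(delta (val e).1) -(delta (val e).2) -sumrB; apply: eq_bigr => w _.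
    by rewrite mulrBl.
  rewrite e2 in h.
  rewrite (eq_bigr (fun k => y k (val e).1 (val e).2 * n (inl k))); last by move=> k _; rewrite mulrC.
  by apply/eqP; rewrite -subr_eq0 opprB h.
have m0 : \sum_k m k = 0.
  have := hn (inr true); rewrite big_sumType /= [X in _ + X]big1 ?addr0; last by move=> v _; rewrite mul0r.
  by under eq_bigr do rewrite mul1r.
have x0 : x v0 = 0.
  have := hn (inr false); rewrite big_sumType /= [X in X + _]big1 ?add0r; last by move=> k _; rewrite mul0r.
  by rewrite delta.
have cl := edge_class_sum (index_enum I) m hy.
have co u v : adj u v -> \sum_k m k * y k u v = x v - x u.
  pose Q (u v : G) := adj u v /\ \sum_k m k * y k u v = x v - x u.
  have Qsym u' v' : Q u' v' -> Q v' u'.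
    by case=> uv e; split; [rewrite adj_sym|rewrite (edge_class_anti cl uv) e opprB].
  have Qe (e : oedge G) : Q (val e).1 (val e).2 by split; [exact: oedge_adj|exact: eqe].
  by move=> /(adj_oedge Qsym Qe) [].
have mz := face_points_indep fa m0 (edge_class_clift cl co).
have xc : forall u v, x u = x v.
  apply: (adj_const hconn) => u v uv; have := co u v uv.
  rewrite big1; last by move=> k _; rewrite mz mul0r.
  by move=> /esym/eqP; rewrite subr_eq0 => /eqP.
move/eqP: ni0; apply; case: i0 => [k|v]; first exact: mz.
by rewrite -/(x v) (xc v v0).
Qed.

(** The bound on families of distinct faces provides a largest one, and a point outside its faces
    would enlarge it. *)
Lemma exhaustive_face_points : exists (N : nat) (a : 'I_N -> R * R),
  face_points a /\ forall z, K z \/ exists i, comp (a i) z.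
Proof.
pose Q N := `[< exists a : 'I_N -> R * R, face_points a >].
have Q0 : exists N, Q N by exists 0%N; apply/asboolP; exists (fun=> 0); split; case.
have bd N : Q N -> (N <= #|edges G| + 2)%N.
  by case/asboolP => a /card_face_points; rewrite card_ord; lia.
case: (ex_maxnP Q0 bd) => N /asboolP [a fa] maxN.
exists N, a; split => // z; have [|Kz] := pselect (K z); first by left.
right; apply: contrapT => nz.
suff /maxN : Q N.+1 by rewrite ltnn.
apply/asboolP; exists (fun i => if unlift ord_max i is Some j then a j else z); split.
  by move=> i; case: unliftP => [j _|_ //]; exact: fa.1.
move=> i j; case: unliftP => [i' ->|->]; case: unliftP => [j' ->|->] //.
- by move=> /fa.2 ->.
- by move=> h; case: nz; exists i'.
- by move=> /connected_component_sym h; case: nz; exists j'.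
Qed.

End FaceCountUpperBound.

(** * Faces bounded by short cycles, and the lower bound for their number *)

Section FaceStructure.
Variables (R : realType) (G : graph) (D : plane_drawing R G).
Hypothesis hconn : k_connected 5 G.
Local Notation K := (drawing_support D).
Local Notation comp := (connected_component (~` K)).
Variables (N : nat) (a : 'I_N -> R * R) (c : 'I_N -> seq G).
Hypothesis fa : face_points D a.
Hypothesis cover : forall z, K z \/ exists i, comp (a i) z.
Hypothesis hc : forall i, bounded_by D (comp (a i)) (c i).
Let U i := comp (a i).
Let C i := cycle_support D (c i).

Let cyc i : is_cycle (c i).
Proof. by case: (hc i). Qed.

Let oU i : open (U i).
Proof. by apply: component_open; exact: support_closed. Qed.

Let UK i z : U i z -> ~ K z.
Proof. exact: comp_off. Qed.

Let CK i : C i `<=` K.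
Proof. by apply: cycle_support_sub; exact: cyc. Qed.

Let cC i : compact (C i).
Proof. by apply: cycle_support_compact; exact: cyc. Qed.

Let CcU i : C i `<=` closure (U i).
Proof. by rewrite /C; case: (hc i) => _ <- z []. Qed.

Let cU i : closure (U i) `<=` U i `|` C i.
Proof.
move=> z cz; have [Uz|Uz] := pselect (U i z); [by left|right].
rewrite /C; case: (hc i) => _ <-; split => // Iz; apply: Uz.
exact: interior_subset Iz.
Qed.

Let Udisj i j z : U i z -> U j z -> i = j.
Proof.
move=> Ui Uj; apply: fa.2; apply: connected_component_trans Ui _.
exact: connected_component_sym.
Qed.

Let Ua i : U i (a i).
Proof. by apply: comp_self; exact: fa.1. Qed.

Lemma drawing_lift_all al y : ccont K al -> edge_class D al y ->
  (forall i, winding y (c i) = 0) -> clift K al.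
Proof.
move=> cal cl w; apply: (@lift_of_face_lifts R K N U C) => //.
- exact: support_compact.
- by move=> i; exact: (cycle_lift cl).
Qed.

(* An edge avoiding the single boundary cycle would be a bridge. *)
Lemma two_faces i : (size (c i) < 6)%N -> exists j, j != i.
Proof.
move=> ci; apply: contrapT => nj.
have alli j : j = i by apply/eqP; apply: contrapT => /negP h; apply: nj; exists j.
have [w wc] : exists w, w \notin c i.
  apply/existsP; apply: contraT; rewrite negb_exists => /forallP k.
  have : (#|G| <= #|c i|)%N by apply: subset_leq_card; apply/fintype.subsetP => w _; have := k w; rewrite negbK.
  have := card_size (c i); have := five_lt_card hconn; lia.
have [v wv _] := other_neighbour hconn w w.
(* The edge [wv] is off the only boundary cycle, so its indicator has winding 0 there; the function
   realizing it lifts, and the indicator would be a coboundary. *)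
have [al cal cl] := edge_class_realize D (fun u' v' _ => edge_indicator_anti w v u' v').
have h j : winding (edge_indicator w v) (c j) = 0.
  rewrite /winding big_seq big1 // => u uc; rewrite (alli j) in uc *.
  have uw : u != w by apply/eqP => e; rewrite -e uc in wc.
  have nw : next (c i) u != w by apply/eqP => e; rewrite -e mem_next uc in wc.
  by rewrite /edge_indicator (negbTE uw) (negbTE nw) andbF.
have [x hx] := edge_class_unlift cl (drawing_lift_all cal cl h).
apply: (edge_indicator_not_coboundary hconn (x := x) wv) => u' v' uv'.
by apply: hx => //; exact: earc_support.
Qed.

Hypothesis csmall : forall i, (size (c i) < 6)%N.

(** Let [k] and [m] be the windings along the boundary of [i1] of [ang (a i1) - ang (a i2)] and of
    [al]. By independence [k] is nonzero. The combination of [al] and this difference with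
    coefficients [k] and [- m] has winding 0 there, so [lift_missing_face] gives [m] = 0. *)
Lemma drawing_lift al y i1 : ccont K al -> edge_class D al y ->
  (forall i, i != i1 -> winding y (c i) = 0) -> clift K al.
Proof.
move=> cal cl w.
have [i2 i21] := two_faces (csmall i1).
have ccq : ccont K (fun z => ang (a i1) z - ang (a i2) z).
  by apply: ccontD; [|apply: ccontN]; apply: ccont_ang; exact: fa.1.
have [yq clq] := edge_class_exists ccq.
pose k := winding yq (c i1); pose m := winding y (c i1).
have k0 : k != 0.
  apply/eqP => k0; have hl := cycle_lift clq (cyc i1) k0.
  have := @lift_indep R (C i1) (U i1) bool (fun b => if b then a i1 else a i2)
    (fun b => if b then 1 else -1) true (@cC i1) (@oU i1) _ (@cU i1) (Ua i1).
  have h1 z : U i1 z -> ~ C i1 z by move=> Uz /CK; exact: UK Uz.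
  have h2 (b : bool) : b != true -> ~ U i1 (if b then a i1 else a i2).
    case: b => // _ h; move/eqP: i21; apply; exact: Udisj (Ua i2) h.
  have h3 (b : bool) : ~ C i1 (if b then a i1 else a i2).
    by case: b => /CK; apply: fa.1.
  have h4 : \sum_(b : bool) (if b then 1 else -1) = 0 :> int by rewrite big_bool.
  have h5 : clift (C i1) (fun z => \sum_(b : bool) (if b then 1 else -1 : int)%:~R * ang (if b then a i1 else a i2) z).
    apply: clift_eqm hl => z _; rewrite big_bool /= mulrN1z mulr1z mul1r mulN1r; exact: eqm_refl.
  by move=> /(_ h1 h2 h3 h4 h5).
have m0 : m = 0.
  have := @lift_missing_face R K N U C (support_compact (D := D)) oU UK cC CK cU Udisj cover al i1 (a i1) (a i2) k m cal.
  apply.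
  - by move=> i ii1; apply: (cycle_lift cl) => //; exact: w.
  - exact: Ua.
  - by move=> h; move/eqP: i21; apply; exact: Udisj (Ua i2) h.
  - exact: fa.1.
  - apply: cliftW (fun z h => h) _.
    have cl2 := edge_classD (edge_classMz k cl) (edge_classMz (- m) clq).
    have := cycle_lift cl2 (cyc i1).
    rewrite /winding big_split /= -!mulr_sumr -/(winding y (c i1)) -/(winding yq (c i1)) -/k -/m.
    have -> : k * m + - m * k = 0 by ring.
    move=> /(_ erefl) h; apply: clift_eqm h => z _.
    by rewrite mulrNz mulNr; exact: eqm_refl.
apply: (drawing_lift_all cal cl) => i.
by have [->|] := eqVneq i i1; [exact: m0|exact: w].
Qed.

(** Dual to the upper bound: otherwise there is a nonzero solution of the system [A]. Its cochain
    [y] has winding 0 around all faces but [i1], so it is a coboundary; it is also free of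
    divergence, so it is orthogonal to itself and vanishes. Both slack variables vanish as well. *)
Lemma card_faces_lower : (0 < N)%N -> (#|edges G| + 2 <= N + #|G|)%N.
Proof.
move=> N0; rewrite leqNgt; apply/negP => lt.
have /card_gt0P [v0 _] : (0 < #|G|)%N by apply: leq_trans (five_lt_card hconn).
pose i1 : 'I_N := Ordinal N0.
pose ind (e : oedge G) u v : int := ((val e == (u, v))%:R - (val e == (v, u))%:R).
(* The unknowns are one integer per edge and two slacks. The equations ask for winding 0 around each
   face, with a slack at [i1], and for divergence 0 at each vertex, with a slack at [v0]. *)
pose A (j : 'I_N + G) (i : oedge G + bool) : int :=
  match j, i with
  | inl k, inl e => winding (ind e) (c k)
  | inl k, inr b => (b && (k == i1))%:R
  | inr v, inl e => ((val e).1 == v)%:R - ((val e).2 == v)%:R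
  | inr v, inr b => (~~ b && (v == v0))%:R
  end.
have [|n [[e0 ne0] hn]] := @int_system_solution (oedge G + bool)%type ('I_N + G)%type A.
  by rewrite !card_sum card_bool card_oedge card_ord.
pose Y e := n (inl e); pose y u v := \sum_e Y e * ind e u v.
have anti u v : adj u v -> y v u = - y u v.
  by move=> _; rewrite /y -sumrN; apply: eq_bigr => e _; rewrite /ind -mulrN opprB.
have wy k : winding y (c k) = \sum_e winding (ind e) (c k) * Y e.
  rewrite /winding /y exchange_big /=; apply: eq_bigr => e _.
  by rewrite mulr_suml; apply: eq_bigr => v _; rewrite mulrC.
have eqk k : winding y (c k) + (k == i1)%:R * n (inr true) = 0.
  have := hn (inl k); rewrite big_sumType /= big_bool /= mul0r addr0 => <-.
  by rewrite wy.
have eqv v : \sum_e (((val e).1 == v)%:R - ((val e).2 == v)%:R) * Y e + (v == v0)%:R * n (inr false) = 0.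
  by have := hn (inr v); rewrite big_sumType /= big_bool /= mul0r add0r.
have sum1 (w : G) (f : G -> int) : \sum_v (w == v)%:R * f v = f w.
  rewrite (bigD1 w) //= eqxx mul1r big1 ?addr0 // => v vw.
  by rewrite eq_sym (negbTE vw) mul0r.
have sumY (x : G -> int) :
    \sum_v x v * (\sum_e (((val e).1 == v)%:R - ((val e).2 == v)%:R) * Y e) =
    \sum_e (x (val e).1 - x (val e).2) * Y e.
  under eq_bigr do rewrite mulr_sumr.
  rewrite exchange_big /=; apply: eq_bigr => e _.
  rewrite -(sum1 (val e).1 x) -(sum1 (val e).2 x) -sumrB mulr_suml.
  by apply: eq_bigr => v _; ring.
(* Summed over all vertices the divergences cancel, so the slack at [v0] is 0. *)
have t0 : n (inr false) = 0.
  have := sumY (fun=> 1); rewrite [RHS]big1; last by move=> e _; rewrite subrr mul0r.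
  under eq_bigr => v _.
    rewrite mul1r (_ : \sum_e _ = - ((v == v0)%:R * n (inr false))); last first.
      by apply/eqP; rewrite -addr_eq0 eqv.
    over.
  rewrite sumrN; under eq_bigr do rewrite eq_sym.
  by rewrite (sum1 v0 (fun=> n (inr false))) => /eqP; rewrite oppr_eq0 => /eqP.
have [al cal cl] := edge_class_realize D anti.
have [x hx] : exists x, forall u v, adj u v -> y u v = x v - x u.
  have hl : clift K al.
    apply: (drawing_lift (i1 := i1) cal cl) => i /negbTE ii1.
    by have := eqk i; rewrite ii1 mul0r addr0.
  have [x hx] := edge_class_unlift cl hl.
  by exists x => u v uv; apply: hx => //; exact: earc_support.
have s0 : n (inr true) = 0.
  have := eqk i1; rewrite eqxx mul1r.
  rewrite (_ : winding y (c i1) = 0) ?add0r //.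
  rewrite -(winding_coboundary x (is_cycle_uniq (cyc i1))).
  by apply: winding_eq => v vc; apply: hx; exact: is_cycle_adj.
have yY e : y (val e).1 (val e).2 = Y e.
  rewrite /y (bigD1 e) //= big1 ?addr0 => [|e' e'e].
    rewrite /ind -surjective_pairing eqxx.
    suff -> : (val e == ((val e).2, (val e).1)) = false by rewrite subr0 mulr1.
    apply/negP => /eqP h; have := oedge_adj e; rewrite h /=.
    by rewrite {1}h /= (_ : (val e).1 = (val e).2) ?adj_irr // {1}h.
  rewrite /ind -surjective_pairing (inj_eq val_inj) (negbTE e'e) sub0r.
  suff -> : (val e' == ((val e).2, (val e).1)) = false by rewrite oppr0 mulr0.
  apply/negP => /eqP h; case: e' e {e'e} h => p' hp' [p hp] /= h.
  move: hp' hp; rewrite h /= => /andP[vu up'] /andP[uv up].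
  have n12 : p.1 != p.2 by apply/eqP => e'; rewrite e' adj_irr in uv.
  by rewrite upward_total // up' in up.
(* Pairing the coboundary of [x] with the divergence-free [Y] gives 0, and this pairing is a sum of
   squares up to sign. *)
have Y0 e : Y e = 0.
  have := sumY x; rewrite [LHS]big1; last first.
    by move=> v _; have := eqv v; rewrite t0 mulr0 addr0 => ->; rewrite mulr0.
  rewrite (eq_bigr (fun e => - (Y e) ^+ 2)); last first.
    by move=> e' _; rewrite -{2}yY (hx _ _ (oedge_adj e')) -yY (hx _ _ (oedge_adj e')); ring.
  rewrite sumrN => /esym/eqP; rewrite oppr_eq0 psumr_eq0; last by move=> ? _; exact: sqr_ge0.
  by move=> /allP/(_ e (mem_index_enum e)) /=; rewrite sqrf_eq0 => /eqP.
move/eqP: ne0; apply; case: e0 => [e|[]] //; exact: Y0.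
Qed.

Lemma card_faces : (0 < N)%N -> (N + #|G| = #|edges G| + 2)%N.
Proof.
move=> N0; apply/eqP; rewrite eqn_leq card_faces_lower // andbT.
by have := card_face_points hconn fa; rewrite card_ord.
Qed.

Definition incident i (u v : G) :=
  ((u \in c i) && (v == next (c i) u)) || ((v \in c i) && (u == next (c i) v)).

Lemma incident_closure i u v : adj u v -> incident i u v -> earc D u v `<=` closure (U i).
Proof.
move=> uv /orP[] /andP[uc /eqP e] z hz; apply: CcU.
  by exists u => //; rewrite -e.
by exists v => //; rewrite -e -(earc_sym D uv).
Qed.

(** If only the cycle of [i1] could contain the edge, its indicator would have winding 0 around all
    other faces and be a coboundary. So every face has a different face incident to the edge, and
    two applications give two incident faces. *)
Lemma two_incident (u v : G) (i0 : 'I_N) : adj u v -> exists i j, [/\ i != j, incident i u v & incident j u v].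
Proof.
move=> uv.
have ex i1 : exists2 i, i != i1 & incident i u v.
  apply: contrapT => nex.
  have [al cal cl] := edge_class_realize D (fun u' v' _ => edge_indicator_anti u v u' v').
  have hl : clift K al.
    apply: (drawing_lift (i1 := i1) cal cl) => i ii1.
    rewrite /winding big_seq big1 // => w wc; rewrite /edge_indicator.
    have ninc : ~~ incident i u v by apply/negP => h; apply: nex; exists i.
    have -> : (w == u) && (next (c i) w == v) = false.
      by apply/negP => /andP[/eqP e1 /eqP e2]; move: ninc; rewrite /incident -e1 wc -e2 eqxx.
    have -> : (w == v) && (next (c i) w == u) = false; last by rewrite subrr.
    by apply/negP => /andP[/eqP e1 /eqP e2]; move: ninc; rewrite /incident -e1 wc -e2 eqxx orbT.
  have [x hx] := edge_class_unlift cl hl.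
  apply: (edge_indicator_not_coboundary hconn (x := x) uv) => u' v' uv'.
  by apply: hx => //; exact: earc_support.
have [i _ hi] := ex i0; have [j ji hj] := ex i.
by exists i, j; split => //; rewrite eq_sym.
Qed.

End FaceStructure.

(** * Deleting an edge: no edge borders three faces *)

Section EdgeRemoval.
Variables (R : realType) (G : graph) (D : plane_drawing R G) (u v : G).
Hypothesis uv : adj u v.
Local Notation K := (drawing_support D).
Local Notation comp := (connected_component (~` K)).
Local Notation pos := (pos D).
Local Notation earc := (earc D).

Definition edge_interior : set (R * R) := [set z | earc u v z /\ forall w, z <> pos w].

Lemma edge_interior_nonempty : exists z, edge_interior z.
Proof.
have [g [cg ig g0 g1 gE]] := earc_arc D uv.
have in01 (t : R) : 0 <= t <= 1 -> t \in `[0%R, 1%R]%classic by rewrite inE /= in_itv.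
have h2 : 0 <= (2^-1 : R) <= 1 by lra.
have m : earc u v (g 2^-1) by rewrite gE; exists 2^-1 => //; have := in01 _ h2; rewrite inE.
exists (g 2^-1); split => // w e.
have i0 : (0 : R) \in `[0%R, 1%R]%classic by apply: in01; rewrite lexx ler01.
have i1 : (1 : R) \in `[0%R, 1%R]%classic by apply: in01; rewrite lexx ler01.
rewrite e in m; case: (earc_vertex uv m) => ew; rewrite ew in e.
  by have := ig _ _ (in01 _ h2) i0; rewrite g0 e => /(_ erefl); lra.
by have := ig _ _ (in01 _ h2) i1; rewrite g1 e => /(_ erefl); lra.
Qed.

Definition without_edge : rel G := fun u' v' => adj u' v' && ([set u'; v']%SET != [set u; v]%SET).

Lemma without_edge_sub : subrel without_edge (@adj G).
Proof. by move=> u' v'; rewrite /without_edge => /andP[]. Qed.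

(** Once the edge is deleted, the two faces together with the interior of its arc form a connected
    set off the remaining drawing. *)
Lemma merge_faces p q : ~ K p -> ~ K q ->
  earc u v `<=` closure (comp p) -> earc u v `<=` closure (comp q) ->
  clift (sub_support D without_edge) (fun z => ang p z - ang q z).
Proof.
move=> Kp Kq hp hq.
have conn x : earc u v `<=` closure (comp x) -> connected (comp x `|` edge_interior).
  move=> hx; apply: (@connected_between _ (comp x)).
  - exact: component_connected.
  - by move=> z; left.
  - by move=> z [|[/hx//]]; exact: subset_closure.
have off x : (comp x `|` edge_interior) `<=` ~` sub_support D without_edge.
  move=> z [/comp_off Kz /(sub_supportS without_edge_sub)//|[hz nz]].
  case=> [[w /nz//]|[u' [v' []]]]; rewrite /without_edge => /andP[uv' ne] hz'.
  have [[eu ev]|[eu ev]|[w [/nz//]]] := earc_meet uv uv' hz hz'; subst u' v'.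
    by rewrite eqxx in ne.
  by rewrite finset.setUC eqxx in ne.
apply: (@clift_same_component _ _ ((comp p `|` edge_interior) `|` (comp q `|` edge_interior))).
- apply: compact_closed; first exact: prod_hausdorff.
  by apply: sub_support_compact; exact: without_edge_sub.
- apply: connectedU; [|exact: conn|exact: conn].
  by have [z hz] := edge_interior_nonempty; exists z; split; right.
- by move=> z [/off|/off].
- by left; left; exact: comp_self.
- by right; left; exact: comp_self.
Qed.

(** For the pairs of faces 0, 1 and 0, 2 the classes of [f] are coboundaries off the edge, with
    defects [m1] and [m2] on it. The combination with coefficients [m2] and [- m1] has no defect and
    lifts on the drawing, so independence gives [m1] = [m2] = 0. Then [f o0 o1] itself lifts,
    against independence. *)
Lemma no_three_faces (a : 'I_3 -> R * R) : face_points D a ->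
  ~ (forall i, earc u v `<=` closure (comp (a i))).
Proof.
move=> fa hcl.
pose o0 : 'I_3 := ord0; pose o1 : 'I_3 := inord 1; pose o2 : 'I_3 := inord 2.
have sum3 (T : nmodType) (f : 'I_3 -> T) : \sum_i f i = f o0 + f o1 + f o2.
  rewrite !big_ord_recl big_ord0 addr0 addrA; congr (_ + f _ + f _); apply: val_inj;
  by rewrite /= inordK.
have n01 : (o1 == o0) = false by apply/negP => /eqP/(congr1 val); rewrite /= inordK.
have n02 : (o2 == o0) = false by apply/negP => /eqP/(congr1 val); rewrite /= inordK.
have n12 : (o2 == o1) = false by apply/negP => /eqP/(congr1 val); rewrite /= !inordK.
pose f i j z := ang (a i) z - ang (a j) z.
have cf i j : ccont K (f i j).
  by apply: ccontD; [|apply: ccontN]; apply: ccont_ang; exact: fa.1.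
have main i j : exists (y : G -> G -> int) (x : G -> int), edge_class D (f i j) y /\
    forall u' v', without_edge u' v' -> y u' v' = x v' - x u'.
  have [y cl] := edge_class_exists (cf i j).
  have hl := merge_faces (fa.1 i) (fa.1 j) (hcl i) (hcl j).
  have [x hx] := edge_class_unlift cl hl.
  exists y, x; split => // u' v' h; apply: hx; first exact: without_edge_sub.
  by move=> z hz; right; exists u', v'.
have [y1 [x1 [cl1 h1]]] := main o0 o1; have [y2 [x2 [cl2 h2]]] := main o0 o2.
pose m1 := y1 u v - (x1 v - x1 u); pose m2 := y2 u v - (x2 v - x2 u).
have cl := edge_classD (edge_classMz m2 cl1) (edge_classMz (- m1) cl2).
have co u' v' : adj u' v' -> m2 * y1 u' v' + - m1 * y2 u' v' =
    (m2 * x1 v' - m1 * x2 v') - (m2 * x1 u' - m1 * x2 u').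
  move=> uv'; have e0 : m2 * y1 u v + - m1 * y2 u v = (m2 * x1 v - m1 * x2 v) - (m2 * x1 u - m1 * x2 u).
    by rewrite /m1 /m2; ring.
  have [h|/negPn/eqP h] := boolP ([set u'; v']%SET != [set u; v]%SET).
    by rewrite h1 ?h2 /without_edge ?uv' ?h //; ring.
  have nuv : u' != v' by exact: adj_neq.
  have : u' \in [set u; v]%SET by rewrite -h set21.
  have : v' \in [set u; v]%SET by rewrite -h set22.
  rewrite !inE => /orP[] /eqP ev /orP[] /eqP eu; subst u' v'; rewrite ?eqxx // in nuv.
  rewrite (edge_class_anti cl1 uv) (edge_class_anti cl2 uv).
  by transitivity (- (m2 * y1 u v + - m1 * y2 u v)); [ring|rewrite e0; ring].
have hl := edge_class_clift cl co.
pose n i : int := if i == o0 then m2 - m1 else if i == o1 then - m2 else m1.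
have ns : \sum_i n i = 0.
  by rewrite sum3 /n eqxx n01 n02 n12 eqxx; ring.
have hn : clift K (fun z => \sum_i (n i)%:~R * ang (a i) z).
  apply: clift_eqm hl => z _; rewrite sum3 /n eqxx n01 n02 n12 eqxx /f.
  set X := (X in eqm X _); set Y := (X in eqm _ X).
  suff -> : X = Y by exact: eqm_refl.
  by rewrite /X /Y intrB !mulrNz; ring.
have nz := face_points_indep fa ns hn.
have m20 : m2 = 0 by have := nz o1; rewrite /n n01 eqxx; lia.
have m10 : m1 = 0 by have := nz o2; rewrite /n n02 n12.
have co1 u' v' : adj u' v' -> y1 u' v' = x1 v' - x1 u'.
  move=> uv'; have [h|/negPn/eqP h] := boolP ([set u'; v']%SET != [set u; v]%SET).
    by rewrite h1 // /without_edge uv' h.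
  have nuv : u' != v' by exact: adj_neq.
  have e0 : y1 u v = x1 v - x1 u by apply/eqP; rewrite -subr_eq0 -/m1 m10.
  have : u' \in [set u; v]%SET by rewrite -h set21.
  have : v' \in [set u; v]%SET by rewrite -h set22.
  rewrite !inE => /orP[] /eqP ev /orP[] /eqP eu; subst u' v'; rewrite ?eqxx // in nuv.
  by rewrite (edge_class_anti cl1 uv) e0 opprB.
have hl1 := edge_class_clift cl1 co1.
pose n' i : int := if i == o0 then 1 else if i == o1 then -1 else 0.
have ns' : \sum_i n' i = 0 by rewrite sum3 /n' eqxx n01 n02 n12 eqxx.
have hn' : clift K (fun z => \sum_i (n' i)%:~R * ang (a i) z).
  apply: clift_eqm hl1 => z _; rewrite sum3 /n' eqxx n01 n02 n12 eqxx /f.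
  by rewrite mulr1z mulrN1z mulr0z mul1r mulN1r mul0r addr0; exact: eqm_refl.
by have := face_points_indep fa ns' hn' o0; rewrite /n' eqxx.
Qed.

End EdgeRemoval.

(** * Counting edges along face boundaries *)

Section CountEdges.
Variables (R : realType) (G : graph) (D : plane_drawing R G).
Hypothesis hconn : k_connected 5 G.
Local Notation K := (drawing_support D).
Local Notation comp := (connected_component (~` K)).
Variables (N : nat) (a : 'I_N -> R * R) (c : 'I_N -> seq G).
Hypothesis fa : face_points D a.
Hypothesis cover : forall z, K z \/ exists i, comp (a i) z.
Hypothesis hc : forall i, bounded_by D (comp (a i)) (c i).
Hypothesis csmall : forall i, (size (c i) < 6)%N.

Lemma next_next_neq (T : eqType) (s : seq T) x : uniq s -> (2 < size s)%N -> x \in s ->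
  next s (next s x) != x.
Proof.
move=> us s2 xs; apply/eqP => e.
have := next_index us xs; have : next s x \in s by rewrite mem_next.
move=> /(next_index us); rewrite e => e1 e2; move: e1; rewrite e2.
have : (index x s < size s)%N by rewrite index_mem.
move: (index x s) (size s) s2 => k n n2.
by have [h1|h1] := eqVneq k.+1 n; rewrite /=; case: ifP => h2; lia.
Qed.

(** Each edge of the cycle corresponds to its tail [f e] in the cyclic order; as the cycle has more
    than two vertices, only one end of the edge is followed by the other. *)
Lemma card_incident i : #|[set e : oedge G | incident c i (val e).1 (val e).2]%SET| = size (c i).
Proof.
have [cc _] := hc i.
have us := is_cycle_uniq cc; have s2 : (2 < size (c i))%N by case/andP: cc.
pose f (e : oedge G) : G := if next (c i) (val e).1 == (val e).2 then (val e).1 else (val e).2.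
have fin : forall e, e \in [set e : oedge G | incident c i (val e).1 (val e).2]%SET ->
   f e \in c i /\ ((val e = (f e, next (c i) (f e))) \/ (val e = (next (c i) (f e), f e))).
  move=> e; rewrite inE /incident /f => /orP[] /andP[h1 /eqP h2].
    rewrite -h2 eqxx; split => //; left; rewrite -h2; exact: surjective_pairing.
  case: eqP => h3.
    split; first by rewrite h2 mem_next.
    by left; rewrite h3; exact: surjective_pairing.
  by split => //; right; rewrite -h2; exact: surjective_pairing.
rewrite -(card_uniqP us) -(card_in_imset (f := f)).
  apply: eq_card => w; apply/imsetP/idP => [[e he ->]|wc]; first by have [] := fin e he.
  have ww : adj w (next (c i) w) by exact: is_cycle_adj.
  have n := adj_neq ww.
  have [up|up] := boolP (upward w (next (c i) w)).
    have ok : adj (w, next (c i) w).1 (w, next (c i) w).2 && upward (w, next (c i) w).1 (w, next (c i) w).2 by rewrite /= ww.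
    exists (exist (fun p : G * G => adj p.1 p.2 && upward p.1 p.2) _ ok); first by rewrite inE /= /incident wc eqxx.
    by rewrite /f /= eqxx.
  have ok : adj (next (c i) w, w).1 (next (c i) w, w).2 && upward (next (c i) w, w).1 (next (c i) w, w).2.
    by rewrite /= adj_sym ww upward_total // eq_sym.
  exists (exist (fun p : G * G => adj p.1 p.2 && upward p.1 p.2) _ ok); first by rewrite inE /= /incident wc eqxx orbT.
  by rewrite /f /= (negbTE (next_next_neq us s2 wc)).
move=> e1 e2 h1 h2 ef; have [_ k1] := fin e1 h1; have [_ k2] := fin e2 h2.
apply: val_inj; rewrite ef in k1.
have := valP e1; have := valP e2.
case: k1 k2 => e1E [] e2E; rewrite e1E e2E //= => /andP[a2 u2] /andP[a1 u1].
  by move: u1; rewrite upward_total ?u2 // adj_neq.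
by move: u1; rewrite upward_total ?u2 // adj_neq.
Qed.

Lemma two_incident_faces (e : oedge G) : (0 < N)%N ->
  #|[set i | incident c i (val e).1 (val e).2]%SET| = 2%N.
Proof.
move=> N0; have uv := oedge_adj e.
apply/eqP; rewrite eqn_leq; apply/andP; split; last first.
  have [i [j [ij hi hj]]] := two_incident hconn fa cover hc csmall (Ordinal N0) uv.
  have <- : #|[set i; j]%SET| = 2%N by rewrite cards2 ij.
  by apply: subset_leq_card; apply/fintype.subsetP => k; rewrite !inE => /orP[] /eqP ->.
rewrite leqNgt; apply/negP => h3.
pose b (k : 'I_3) : 'I_N := enum_val (widen_ord h3 k).
have binj : injective b by move=> k l /enum_val_inj /(congr1 val) /= /val_inj.
have fb : face_points D (fun k => a (b k)).
  by split=> [k|k l /fa.2 /binj //]; exact: fa.1.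
apply: (no_three_faces uv fb) => k.
have := enum_valP (widen_ord h3 k); rewrite inE => hk.
exact: (incident_closure hc uv hk).
Qed.

(** The pairs of a face and an edge on its boundary are counted in two ways. *)
Lemma sum_face_sizes : (0 < N)%N -> (\sum_i size (c i) = 2 * #|edges G|)%N.
Proof.
move=> N0.
transitivity (\sum_i \sum_(e : oedge G | incident c i (val e).1 (val e).2) 1)%N.
  by apply: eq_bigr => i _; rewrite -(card_incident i) -sum1_card; apply: eq_bigl => e; rewrite inE.
rewrite (exchange_big_dep xpredT) //=.
transitivity (\sum_(e : oedge G) 2)%N.
  by apply: eq_bigr => e _; rewrite -(two_incident_faces e N0) -sum1_card; apply: eq_bigl => i; rewrite inE.
by rewrite sum_nat_const card_oedge mulnC.
Qed.

End CountEdges.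

(** With N faces, V vertices and E edges, one face has length 4 and the others 3, so 3 N + 1 = 2 E;
    Euler's formula N + V = E + 2 eliminates N. *)
Lemma plane_edge_count (R : realType) (G : graph) (D : plane_drawing R G) (F0 : set (R * R))
    (c0 : seq G) :
  k_connected 5 G -> is_face D F0 -> size c0 = 4%N -> bounded_by D F0 c0 ->
  (forall F, is_face D F -> F <> F0 -> face_length D F 3) ->
  (#|edges G| + 7 = 3 * #|G|)%N.
Proof.
move=> hconn [z0 Kz0 F0E] s0 bF0 hF.
have [N [a [fa cover]]] := exhaustive_face_points D hconn.
have [//|[i0 hi0]] := cover z0.
have F0i : connected_component (~` drawing_support D) (a i0) = F0.
  by rewrite F0E; exact: same_connected_component.
have isf i : is_face D (connected_component (~` drawing_support D) (a i)).
  by exists (a i) => //; exact: fa.1.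
have /choice [c hc] : forall i, exists ci : seq G,
    bounded_by D (connected_component (~` drawing_support D) (a i)) ci /\
    size ci = (if i == i0 then 4 else 3)%N.
  move=> i; have [->|ne] := eqVneq i i0; first by exists c0; rewrite F0i.
  have [|ci si bi] := hF _ (isf i); last by exists ci.
  move=> e; move/eqP: ne; apply; apply/esym/fa.2.
  by rewrite F0i -e; apply: comp_self; exact: fa.1.
have hb i : bounded_by D (connected_component (~` drawing_support D) (a i)) (c i).
  by case: (hc i).
have sz i : size (c i) = (if i == i0 then 4 else 3)%N by case: (hc i).
have small i : (size (c i) < 6)%N by rewrite sz; case: ifP.
have N0 : (0 < N)%N by apply: leq_ltn_trans (ltn_ord i0).
have e1 := card_faces hconn fa cover hb small N0.
have := sum_face_sizes hconn fa cover hb small N0.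
rewrite (eq_bigr (fun i => 3 + (i == i0))%N); last by move=> i _; rewrite sz; case: ifP.
rewrite big_split /= sum_nat_const card_ord.
have -> : (\sum_(i < N) (i == i0) = 1)%N.
  by rewrite (bigD1 i0) //= eqxx big1 // => i /negbTE ->.
move: (five_lt_card hconn) e1; move: #|edges G| #|G| => E V; lia.
Qed.

(** * Crossing paths *)

Section CrossingPaths.
Variables (R : realType) (G : graph) (D : plane_drawing R G).
Local Notation K := (drawing_support D).
Local Notation pos := (pos D).
Local Notation earc := (earc D).

Fixpoint path_support (u : G) (p : seq G) : set (R * R) :=
  if p is v :: q then earc u v `|` path_support v q else [set pos u].

Lemma path_support_compact u p : path (@adj G) u p -> compact (path_support u p).
Proof.
elim: p u => [|v q ih] u /=; first by move=> _; exact: compact_set1.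
by case/andP => uv /ih h; apply: compactU => //; exact: earc_compact.
Qed.

Lemma path_support_mem u p w : path (@adj G) u p -> w \in u :: p -> path_support u p (pos w).
Proof.
elim: p u => [|v q ih] u /=; first by move=> _; rewrite inE => /eqP ->.
case/andP => uv hq; rewrite inE => /orP[/eqP ->|wq]; last by right; exact: ih.
by left; have [] := earc_pos D uv.
Qed.

Lemma path_support_connected u p : path (@adj G) u p -> connected (path_support u p).
Proof.
elim: p u => [|v q ih] u /=; first by move=> _; exact: connected1.
case/andP => uv hq; apply: connectedU; [|exact: earc_connected|exact: ih].
exists (pos v); split; first by have [] := earc_pos D uv.
by apply: path_support_mem => //; rewrite inE eqxx.
Qed.

(** [S] lies in the drawing of the subgraph induced by [W]; intersections of such sets are then
    controlled by their vertex sets. *)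
Definition carried (W : {set G}) (S : set (R * R)) := forall z, S z ->
  (exists2 w, w \in W & z = pos w) \/
  exists u v, [/\ u \in W, v \in W, adj u v & earc u v z].

Lemma carried_path (W : {set G}) u p : path (@adj G) u p -> {subset u :: p <= W} ->
  carried W (path_support u p).
Proof.
elim: p u => [|v q ih] u /=.
  by move=> _ sub z ->; left; exists u => //; apply: sub; rewrite inE.
case/andP => uv hq sub z [hz|]; last first.
  by apply: ih => // w wq; apply: sub; rewrite inE wq orbT.
by right; exists u, v; split => //; apply: sub; rewrite !inE eqxx ?orbT.
Qed.

Lemma carried_earc (W : {set G}) u v : adj u v -> u \in W -> v \in W -> carried W (earc u v).
Proof. by move=> uv uW vW z hz; right; exists u, v. Qed.

Lemma carriedU (W : {set G}) S S' : carried W S -> carried W S' -> carried W (S `|` S').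
Proof. by move=> h h' z [/h|/h']. Qed.

Lemma carriedW (W W' : {set G}) S : {subset W <= W'} -> carried W S -> carried W' S.
Proof.
move=> s h z /h [[w wW ->]|[u [v [uW vW uv hz]]]]; first by left; exists w => //; exact: s.
by right; exists u, v; split => //; exact: s.
Qed.

Lemma carried_support W S : carried W S -> S `<=` K.
Proof.
move=> h z /h [[w _ ->]|[u [v [_ _ uv hz]]]]; first by left; exists w.
by right; exists u, v.
Qed.

(** Arcs of different edges meet only in common ends, and the edge [uv] is not among those inside
    [W]. *)
Lemma carried_meet (W : {set G}) S u v z : carried W S -> S z -> adj u v -> earc u v z ->
  ~~ ((u \in W) && (v \in W)) -> exists2 w, w \in W & z = pos w /\ (w = u \/ w = v).
Proof.
move=> h Sz uv hz nW; case: (h z Sz) => [[w wW zw]|[u' [v' [uW vW uv' hz']]]].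
  by exists w => //; split => //; rewrite zw in hz; exact: earc_vertex uv hz.
have [[eu ev]|[eu ev]|[w [zw w1 w2]]] := earc_meet uv uv' hz hz'; subst.
- by rewrite uW vW in nW.
- by rewrite uW vW in nW.
- by exists w => //; case: w2 => ->.
Qed.

Lemma carried_disjoint (W W' : {set G}) S S' : carried W S -> carried W' S' ->
  [disjoint W & W']%B -> forall z, S z -> S' z -> False.
Proof.
move=> h h' dj z Sz Sz'.
have no w : w \in W -> w \in W' -> False.
  by move=> wW wW'; move/disjoint_setI0: dj => /setP/(_ w); rewrite !inE wW wW'.
case: (h' z Sz') => [[w wW' zw]|[u [v [uW vW uv hz]]]].
  case: (h z Sz) => [[w' wW zw']|[u [v [uW vW uv hz]]]].
    by apply: (no w) => //; rewrite (pos_inj (etrans (esym zw) zw')).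
  rewrite zw in hz; by have [e|e] := earc_vertex uv hz; apply: (no w) => //; rewrite e.
have [|w wW [_ [] e]] := carried_meet h Sz uv hz.
- by apply/negP => /andP[/no/(_ uW)].
- by apply: (no w) => //; rewrite e.
- by apply: (no w) => //; rewrite e.
Qed.

Lemma connected_path (W : {set G}) u v : induces_connected W -> u \in W -> v \in W ->
  exists p, [/\ path (@adj G) u p, last u p = v, uniq (u :: p) & {subset u :: p <= W}].
Proof.
move=> /'forall_in_forall_inP cW uW vW.
have /connectP [p pp pl] := cW u uW v vW.
case/shortenP: pp pl => p' pp' up' _ ->.
exists p'; split => //; first by apply: sub_path pp' => a b /and3P[].
elim: p' u uW pp' {up'} => [|w q ih] u uW /=; first by move=> _ x; rewrite inE => /eqP ->.
case/andP => /and3P[_ wW _] pq x; rewrite inE => /orP[/eqP ->//|]; exact: ih.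
Qed.

Lemma face_no_crossing (F0 : set (R * R)) x1 x2 x3 x4 (W13 W24 : {set G}) :
  is_face D F0 -> bounded_by D F0 [:: x1; x2; x3; x4] ->
  induces_connected W13 -> induces_connected W24 -> [disjoint W13 & W24]%B ->
  x1 \in W13 -> x3 \in W13 -> x2 \in W24 -> x4 \in W24 -> False.
Proof.
move=> [a Ka F0E] [cc fr] c13 c24 dj x1W x3W x2W x4W.
have no w : w \in W13 -> w \in W24 -> False.
  by move=> wW wW'; move/disjoint_setI0: dj => /setP/(_ w); rewrite !inE wW wW'.
have [p [pp pl _ pW]] := connected_path c13 x1W x3W.
have [q [qp ql qu qW]] := connected_path c24 x2W x4W.
have us := is_cycle_uniq cc.
have [[n12 n13 n14] [n23 n24 n34]] :
    [/\ x1 != x2, x1 != x3 & x1 != x4] /\ [/\ x2 != x3, x2 != x4 & x3 != x4].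
  move: us; rewrite /= !inE !negb_or => /and4P[/and3P[-> -> ->] /andP[-> ->] -> _]; by split.
have [a12 a23 a34 a41] : [/\ adj x1 x2, adj x2 x3, adj x3 x4 & adj x4 x1].
  by case/andP: cc => _ /andP[/= /and5P[-> -> -> -> _]].
(* The path from [x2] to the different vertex [x4] has a first edge, from [x2] to [v1]. *)
case: q qp ql qu qW => [|v1 q] /=; first by move=> _ e; rewrite e eqxx in n24.
case/andP => a2v qp ql /andP[x2q _] qW.
have v1W : v1 \in W24 by apply: qW; rewrite !inE eqxx orbT.
pose P := path_support x1 p.
have P1 : P (pos x1) by apply: path_support_mem => //; rewrite inE eqxx.
have P3 : P (pos x3) by apply: path_support_mem => //; rewrite -pl mem_last.
have cP : carried W13 P by exact: carried_path.
pose A1 := earc x1 x2 `|` earc x2 x3; pose A2 := earc x3 x4 `|` earc x4 x1.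
have cA1 : carried (x2 |: W13) A1.
  by apply: carriedU; apply: carried_earc; rewrite ?inE ?eqxx ?x1W ?x3W ?orbT.
have cA2 : carried (x4 |: W13) A2.
  by apply: carriedU; apply: carried_earc; rewrite ?inE ?eqxx ?x1W ?x3W ?orbT.
(* The three vertices of [A2] alone also carry it, which allows its intersection with [A1] to be
   computed without reference to [W13]. *)
have cA2' : carried [set x1; x3; x4]%SET A2.
  by apply: carriedU; apply: carried_earc; rewrite ?inE ?eqxx ?orbT.
have cP1 : carried (x2 |: W13) P by apply: carriedW cP => w wW; rewrite !inE wW orbT.
have cP2 : carried (x4 |: W13) P by apply: carriedW cP => w wW; rewrite !inE wW orbT.
have cC1 := carriedU cP1 cA1; have cC2 := carriedU cP2 cA2.
have Pcl : closed P by apply: compact_closed; [exact: prod_hausdorff|exact: path_support_compact].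
have C1cl : closed (P `|` A1) by apply: closedU => //; apply: closedU; exact: earc_closed.
have C2cl : closed (P `|` A2) by apply: closedU => //; apply: closedU; exact: earc_closed.
have [g [h [cg Ag hg [g0 g1] gE]]] := is_arcP (earc_arc D a2v).
(* An inner point of the first edge: [L1] leads from it back to [x2], and [L2] leads on to [v1]. *)
pose b := g 2^-1.
pose L1 := g @` `[0%R, 2^-1]; pose L2 := g @` `[2^-1, 1%R].
have F0K z : F0 z -> ~ K z by rewrite F0E => /comp_off.
have F0a : F0 a by rewrite F0E; exact: comp_self.
have F0c : connected F0 by rewrite F0E; exact: component_connected.
have fcl v : v \in [:: x1; x2; x3; x4] -> closure F0 (pos v).
  move=> vc; have : cycle_support D [:: x1; x2; x3; x4] (pos v).
    exists v => //; have [] // := earc_pos D (is_cycle_adj cc vc).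
  by rewrite -fr => -[].
have L1b : L1 b by exists 2^-1 => //; rewrite /= in_itv /= lexx andbT invr_ge0 ler0n.
have L2b : L2 b by exists 2^-1 => //; rewrite /= in_itv /= lexx /= invf_le1 ?ler1n ?ltr0n.
have L1x : L1 (pos x2) by exists 0 => //; rewrite /= in_itv /= lexx invr_ge0 ler0n.
have L2v : L2 (pos v1) by exists 1 => //; rewrite /= in_itv /= lexx andbT invf_le1 ?ler1n ?ltr0n.
have L1c : connected L1.
  apply: connected_continuous_connected; first exact: segment_connected.
  exact: continuous_subspaceT.
have L2c : connected L2.
  apply: connected_continuous_connected; first exact: segment_connected.
  exact: continuous_subspaceT.
have L1e z : L1 z -> earc x2 v1 z by case=> t _ <-.
have L2e z : L2 z -> earc x2 v1 z by case=> t _ <-.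
have L1v : ~ L1 (pos v1).
  case=> t /= ; rewrite in_itv /= => /andP[t0 t1] e.
  have := hg 1; rewrite g1 -e hg ?lexx ?ler01 => [/(_ erefl)|]; last by apply/andP; split; lra.
  lra.
have L2x : ~ L2 (pos x2).
  case=> t /= ; rewrite in_itv /= => /andP[t0 t1] e.
  have := hg 0; rewrite g0 -e hg ?lexx ?ler01 => [/(_ erefl)|]; last by apply/andP; split; lra.
  lra.
have L1off z : L1 z -> ~ (P `|` A2) z.
  move=> Lz Cz; have [|w wW [zw we]] := carried_meet cC2 Cz a2v (L1e _ Lz).
    by rewrite !inE negb_and (negbTE n24) /=; case: (boolP (x2 \in W13)) => // /no/(_ x2W).
  case: we => we; subst w.
    by move: wW; rewrite !inE (negbTE n24) /= => /no/(_ x2W).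
  by apply: L1v; rewrite -zw.
have nv2 : v1 != x2 by rewrite eq_sym; move: x2q; rewrite inE negb_or => /andP[].
have L2off z : L2 z -> ~ (P `|` A1) z.
  move=> Lz Cz; have [|w wW [zw we]] := carried_meet cC1 Cz a2v (L2e _ Lz).
    by rewrite !inE negb_and (negbTE nv2) /=; case: (boolP (v1 \in W13)) => [/no/(_ v1W)//|_]; rewrite orbT.
  case: we => we; subst w.
    by apply: L2x; rewrite -zw.
  by move: wW; rewrite !inE (negbTE nv2) /= => /no/(_ v1W).
pose Q := path_support v1 q.
(* The path is simple, so after its first edge it does not return to [x2]. *)
have cQ : carried (W24 :\ x2) Q.
  apply: carried_path => // w wq; rewrite !inE; apply/andP; split.
    by apply: contraNneq x2q => <-.
  by apply: qW; rewrite inE wq orbT.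
have Qoff z : Q z -> ~ (P `|` A1) z.
  move=> Qz Cz; apply: (carried_disjoint cQ cC1 _ Qz Cz).
  rewrite disjoint_subset; apply/fintype.subsetP => w; rewrite !inE => /andP[w2 wW].
  by rewrite negb_or w2; apply/negP => /no/(_ wW).
have ins v : v \in [:: x1; x2; x3; x4] -> connected (F0 `|` [set pos v]).
  move=> vc; apply: (connected_between F0c); first by move=> z; left.
  by move=> z [|->]; [exact: subset_closure|exact: fcl].
have m2 : x2 \in [:: x1; x2; x3; x4] by rewrite !inE eqxx !orbT.
have m4 : x4 \in [:: x1; x2; x3; x4] by rewrite !inE eqxx !orbT.
(* From the face to [b] through the corner [x2] and along [L1]: this route meets neither [P] nor
   [A2]. *)
have lift2 : clift (P `|` A2) (fun z => ang a z - ang b z).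
  apply: (@clift_same_component _ _ ((F0 `|` [set pos x2]) `|` L1)) => //.
  - by apply: connectedU => //; [exists (pos x2); split => //; right|exact: ins].
  - move=> z [[/F0K Kz|->]|/L1off//]; last exact: L1off.
    by move=> /(carried_support cC2).
  - by left; left.
  - by right.
have Q1 : Q (pos v1) by apply: path_support_mem => //; rewrite inE eqxx.
have Q4 : Q (pos x4) by apply: path_support_mem => //; rewrite -ql mem_last.
(* From the face to [b] through the opposite corner [x4], along [Q] to [v1] and along [L2]: this
   route meets neither [P] nor [A1]. *)
have lift1 : clift (P `|` A1) (fun z => ang a z - ang b z).
  apply: (@clift_same_component _ _ ((F0 `|` [set pos x4]) `|` (Q `|` L2))) => //.
  - apply: connectedU; first by exists (pos x4); split; [right|left].
      exact: ins.
    apply: connectedU => //; first by exists (pos v1).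
    exact: path_support_connected.
  - move=> z [[/F0K Kz|->]|[/Qoff//|/L2off//]]; last exact: Qoff.
    by move=> /(carried_support cC1).
  - by left; left.
  - by right; right.
(* [A1] and [A2] share only the points of [x1] and [x3], which are on [P]; so the two closed sets
   overlap exactly in the connected set [P]. *)
have lift : clift ((P `|` A1) `|` (P `|` A2)) (fun z => ang a z - ang b z).
  apply: clift_union => //.
  have -> : (P `|` A1) `&` (P `|` A2) = P.
    apply/seteqP; split=> z; last by move=> Pz; split; left.
    case=> [[//|A1z]] [//|A2z].
    case: A1z => hz.
      have [|w] := carried_meet cA2' A2z a12 hz.
        by rewrite !inE (eq_sym x2 x1) (negbTE n12) (negbTE n23) (negbTE n24) andbF.
      rewrite !inE => wW [-> [->//|e]]; move: wW.
      by rewrite e (eq_sym x2 x1) (negbTE n12) (negbTE n23) (negbTE n24).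
    have [|w] := carried_meet cA2' A2z a23 hz.
      by rewrite !inE (eq_sym x2 x1) (negbTE n12) (negbTE n23) (negbTE n24).
    rewrite !inE => wW [-> [e|->//]]; move: wW.
    by rewrite e (eq_sym x2 x1) (negbTE n12) (negbTE n23) (negbTE n24).
  exact: path_support_connected.
have Csub : cycle_support D [:: x1; x2; x3; x4] `<=` (P `|` A1) `|` (P `|` A2).
  move=> z [v]; rewrite !inE => /or4P[] /eqP -> /=;
  rewrite ?eqxx ?(negbTE n12) ?(negbTE n13) ?(negbTE n14) ?(negbTE n23) ?(negbTE n24) ?(negbTE n34)
    ?(eq_sym x2 x1) ?(eq_sym x3 x1) ?(eq_sym x4 x1) ?(eq_sym x3 x2) ?(eq_sym x4 x2) ?(eq_sym x4 x3)
    ?(negbTE n12) ?(negbTE n13) ?(negbTE n14) ?(negbTE n23) ?(negbTE n24) ?(negbTE n34) => hz.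
  - by left; right; left.
  - by left; right; right.
  - by right; right; left.
  - by right; right; right.
have bC : ~ cycle_support D [:: x1; x2; x3; x4] b.
  by move=> /Csub [/L2off//|/L1off//]; apply.
have Kb : K b by right; exists x2, v1; split => //; exact: L1e.
(* Independence for the single face [F0], with coefficient 1 at [a] inside and -1 at [b] outside,
   would give 1 = 0. *)
have := @lift_indep R (cycle_support D [:: x1; x2; x3; x4]) F0 bool (fun i => if i then a else b)
    (fun i => if i then 1 else -1) true.
have h0 : compact (cycle_support D [:: x1; x2; x3; x4]) by exact: cycle_support_compact.
have h1 : open F0 by rewrite F0E; apply: component_open; exact: support_closed.
have h2 z : F0 z -> ~ cycle_support D [:: x1; x2; x3; x4] z.
  by move=> /F0K Kz /(cycle_support_sub cc).
have h3 : closure F0 `<=` F0 `|` cycle_support D [:: x1; x2; x3; x4].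
  move=> z hz; have [Fz|Fz] := pselect (F0 z); [by left|right].
  by rewrite -fr; split => // /interior_subset.
have h4 (i : bool) : i != true -> ~ F0 (if i then a else b) by case: i => // _ /F0K.
have h5 (i : bool) : ~ cycle_support D [:: x1; x2; x3; x4] (if i then a else b).
  by case: i => //; exact: h2.
have h6 : \sum_(i : bool) (if i then 1 else -1) = 0 :> int by rewrite big_bool.
have h7 : clift (cycle_support D [:: x1; x2; x3; x4])
    (fun z => \sum_(i : bool) (if i then 1 else -1 : int)%:~R * ang (if i then a else b) z).
  apply: clift_eqm (cliftW Csub lift) => z _.
  rewrite big_bool /= mulrN1z mulr1z mul1r mulN1r; exact: eqm_refl.
by move=> /(_ h0 h1 h2 h3 F0a h4 h5 h6 h7).
Qed.

End CrossingPaths.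

(** * The cone over a graph *)

Section InducedConnectivity.
Variable G : graph.
Implicit Types A B : {set G}.

Definition induced A : rel G := fun a b => [&& a \in A, b \in A & adj a b].

Lemma induces_connectedP A : reflect (forall u v, u \in A -> v \in A -> connect (induced A) u v)
  (induces_connected A).
Proof.
apply: (iffP 'forall_in_forall_inP) => h; first by move=> u v uA vA; exact: h.
by move=> u uA v vA; exact: h.
Qed.

Lemma induced_connect_sym A : connect_sym (induced A).
Proof.
apply: sym_connect_sym => a b; rewrite /induced adj_sym.
by case: (a \in A); case: (b \in A).
Qed.

Lemma induced_connectS A B u v : A \subset B -> connect (induced A) u v -> connect (induced B) u v.
Proof.
move=> /fintype.subsetP AB; apply: connect_sub => a b /and3P[aA bA ab].
by apply: connect1; rewrite /induced !AB.
Qed.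

Lemma induces_connected_hub A h :
  (forall u, u \in A -> connect (induced A) u h) -> induces_connected A.
Proof.
move=> hub; apply/induces_connectedP => u v uA vA.
by apply: connect_trans (hub u uA) _; rewrite induced_connect_sym; exact: hub.
Qed.

Lemma induces_connectedU A B a b : induces_connected A -> induces_connected B ->
  a \in A -> b \in B -> adj a b -> induces_connected (A :|: B)%SET.
Proof.
move=> /induces_connectedP cA /induces_connectedP cB aA bB ab.
apply: (@induces_connected_hub _ a) => u; rewrite !inE => /orP[uA|uB].
  by apply: induced_connectS (cA u a uA aA); exact: finset.subsetUl.
apply: (connect_trans (induced_connectS (finset.subsetUr A B) (cB u b uB bB))).
by apply: connect1; rewrite /induced !inE aA bB orbT adj_sym.
Qed.

End InducedConnectivity.

Section Cone.
Variable G : graph.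

Lemma cone_preim_connected (A : {set cone G}) : None \notin A -> induces_connected A ->
  induces_connected (Some @^-1: A : {set G})%SET.
Proof.
move=> nA /induces_connectedP cA; apply/induces_connectedP => u v; rewrite !inE => uA vA.
have /connectP [p pp pl] := cA _ _ uA vA.
elim: p u uA pp pl => [|[w|] p ih] u uA /=.
- by move=> _ [->]; exact: connect0.
- case/andP => /and3P[_ wA uw] pp pl; apply: connect_trans (ih w wA pp pl).
  by apply: connect1; rewrite /induced !inE uA wA.
- by case/andP => /and3P[_ wA _]; rewrite wA in nA.
Qed.

Lemma cone_imset_connected (A : {set G}) (B : {set cone G}) u v :
  (forall w, w \in A -> Some w \in B) ->
  connect (induced A) u v -> connect (@induced (cone G) B) (Some u) (Some v).
Proof.
move=> AB /connectP [p pp ->] {v}; elim: p u pp => //= w p ih u /andP[/and3P[uA wA uw] pp].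
apply: connect_trans (ih w pp); apply: connect1.
by rewrite /induced !AB.
Qed.

Lemma card_cone : #|cone G| = #|G|.+1.
Proof. exact: card_option. Qed.

(** A deleted set that misses the apex leaves it adjacent to all other remaining vertices; one that
    contains the apex deletes fewer than [k] vertices of [G]. *)
Lemma cone_k_connected k : k_connected k G -> k_connected k.+1 (cone G).
Proof.
case/andP => kG /forallP cG; apply/andP; split; first by rewrite card_cone ltnS.
apply/forallP => S; apply/implyP; rewrite ltnS => Sk.
have [nS|nS] := boolP (None \in S); last first.
  apply: (@induces_connected_hub (cone G) (~: S)%SET None) => -[u|] uS; last exact: connect0.
  by apply: connect1; rewrite /induced uS inE nS.
pose T := (Some @^-1: S : {set G})%SET.
have TS : (#|T| < k)%N.
  apply: leq_trans Sk; rewrite -(card_imset T (@Some_inj _)) (cardsD1 None S) nS add1n ltnS.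
  apply: subset_leq_card; apply/fintype.subsetP => z /imsetP[w]; rewrite inE => wS ->.
  by rewrite !inE.
have /implyP/(_ TS)/induces_connectedP cT := cG T.
apply/induces_connectedP => -[u|] [v|]; rewrite !inE ?nS // => uS vS.
apply: (@cone_imset_connected (~: T)%SET); first by move=> w; rewrite !inE.
by apply: cT; rewrite !inE.
Qed.

Lemma card_edges_cone : #|edges (cone G)| = (#|edges G| + #|G|)%N.
Proof.
pose f1 (e : {set G}) : {set cone G} := (Some @: e)%SET.
pose f2 (v : G) : {set cone G} := [set None; Some v]%SET.
pose E1 := (f1 @: edges G)%SET; pose E2 := (f2 @: finset.setT)%SET.
have -> : edges (cone G) = (E1 :|: E2)%SET.
  apply/setP => e; rewrite !inE; apply/existsP/orP.
    case=> -[u|] /existsP [[v|]] /andP[uv /eqP ->] //.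
    - left; apply/imsetP; exists [set u; v]%SET; last by rewrite /f1 imsetU1 imset_set1.
      by rewrite inE; apply/existsP; exists u; apply/existsP; exists v; rewrite eqxx andbT.
    - by right; apply/imsetP; exists u => //; rewrite finset.setUC.
    - by right; apply/imsetP; exists v.
  case=> /imsetP.
    case=> f; rewrite inE => /existsP[u /existsP[v /andP[uv /eqP ->]]] ->.
    exists (Some u); apply/existsP; exists (Some v); rewrite /f1 imsetU1 imset_set1 eqxx andbT.
    exact: uv.
  by case=> v _ ->; exists None; apply/existsP; exists (Some v); rewrite eqxx.
rewrite cardsU (_ : E1 :&: E2 = finset.set0)%SET ?cards0 ?subn0; last first.
  apply/setP => e; rewrite !inE; apply/negP => /andP[/imsetP[f _ ->] /imsetP[v _ h]].
  have : None \in f2 v by rewrite !inE.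
  by rewrite -h => /imsetP[].
congr (_ + _)%N; first by rewrite card_imset //; apply: imset_inj; exact: Some_inj.
rewrite card_imset ?cardsT // => u v h.
have : Some u \in f2 v by rewrite -h !inE eqxx.
by rewrite !inE /= => /eqP [].
Qed.

(** The branch set of the root [None] takes up the apex, so the other four branch sets lie in [G].
    The union of two opposite ones is connected through the model edge between them. *)
Lemma cone_rooted_minor_paths (x1 x2 x3 x4 : G) : uniq [:: x1; x2; x3; x4] ->
  complete_rooted_minor 5 ([set Some x1; Some x2; Some x3; Some x4; None]%SET : {set cone G}) ->
  exists W13 W24 : {set G},
    [/\ induces_connected W13, induces_connected W24 & [disjoint W13 & W24]%B] /\
    [/\ x1 \in W13, x3 \in W13, x2 \in W24 & x4 \in W24].
Proof.
move=> us [pi [pinj pX [mu [muE [[_ dj cn me] hpi]]]]].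
have inX z : z \in [set Some x1; Some x2; Some x3; Some x4; None]%SET -> exists i, pi i = z.
  by rewrite -pX => /imsetP[i _ ->]; exists i.
have [i5 e5] : exists i, pi i = None by apply: inX; rewrite !inE eqxx orbT.
have [i1 e1] : exists i, pi i = Some x1 by apply: inX; rewrite !inE eqxx.
have [i2 e2] : exists i, pi i = Some x2 by apply: inX; rewrite !inE eqxx !orbT.
have [i3 e3] : exists i, pi i = Some x3 by apply: inX; rewrite !inE eqxx !orbT.
have [i4 e4] : exists i, pi i = Some x4 by apply: inX; rewrite !inE eqxx !orbT.
have nN i x : pi i = Some x -> None \notin mu i.
  move=> e; have i5i : i5 != i by apply/eqP => h; rewrite -h e5 in e.
  have := hpi i5; rewrite e5 => h5; apply/negP => hi.
  by move/disjoint_setI0: (dj _ _ i5i) => /setP/(_ None); rewrite !inE h5 hi.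
have join i j x x' : pi i = Some x -> pi j = Some x' -> i != j ->
    induces_connected (Some @^-1: (mu i :|: mu j) : {set G})%SET.
  move=> ei ej ij; apply: cone_preim_connected.
    by rewrite inE negb_or (nN _ _ ei) (nN _ _ ej).
  have [|eE [a [b [ai bj eab]]]] := me i j; first exact: ij.
  apply: (induces_connectedU (cn i) (cn j) ai bj).
  move: eE; rewrite eab inE => /existsP[u /existsP[v /andP[uv /eqP h]]].
  have ab : a != b.
    apply/eqP => e; rewrite -e in bj.
    by move/disjoint_setI0: (dj _ _ ij) => /setP/(_ a); rewrite !inE ai bj.
  have : a \in [set u; v]%SET by rewrite -h set21.
  have : b \in [set u; v]%SET by rewrite -h set22.
  rewrite !inE => /orP[] /eqP eb /orP[] /eqP ea.
  - by rewrite ea eb eqxx in ab.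
  - by rewrite ea eb adj_sym.
  - by rewrite ea eb.
  - by rewrite ea eb eqxx in ab.
move: us; rewrite /= !inE !negb_or => /and4P[/and3P[n12 n13 n14] /andP[n23 n24] n34 _].
have neq i j x x' : pi i = Some x -> pi j = Some x' -> x != x' -> i != j.
  by move=> ei ej; apply: contraNneq => e; move: ei; rewrite e ej => -[->].
exists (Some @^-1: (mu i1 :|: mu i3))%SET, (Some @^-1: (mu i2 :|: mu i4))%SET.
split; split.
- exact: join e1 e3 (neq _ _ _ _ e1 e3 n13).
- exact: join e2 e4 (neq _ _ _ _ e2 e4 n24).
- have no i j x x' w : pi i = Some x -> pi j = Some x' -> x != x' -> w \in mu i -> w \in mu j -> False.
    move=> ei ej xx wi wj; move/disjoint_setI0: (dj _ _ (neq _ _ _ _ ei ej xx)) => /setP/(_ w).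
    by rewrite !inE wi wj.
  rewrite disjoint_subset; apply/fintype.subsetP => w; rewrite !inE negb_or => /orP[] h.
    by apply/andP; split; apply/negP => h'; [exact: no e1 e2 n12 h h'|exact: no e1 e4 n14 h h'].
  rewrite eq_sym in n23.
  by apply/andP; split; apply/negP => h'; [exact: no e3 e2 n23 h h'|exact: no e3 e4 n34 h h'].
- by rewrite !inE -e1 hpi.
- by rewrite !inE -e3 hpi orbT.
- by rewrite !inE -e2 hpi.
- by rewrite !inE -e4 hpi orbT.
Qed.

End Cone.

Local Close Scope ring_scope.
Local Close Scope classical_set_scope.

Theorem mainTheorem2 (R : realType) (n : nat) (G0 : graph)
  (D : plane_drawing R G0) (x1 x2 x3 x4 : G0) (F0 : set (R * R))
  (hn : #|G0| = (n - 1)%N)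
  (hconn : k_connected 5 G0)
  (hF0 : is_face D F0)
  (hF0_bound : bounded_by D F0 [:: x1; x2; x3; x4])
  (hfaces : forall F : set (R * R), is_face D F -> F <> F0 -> face_length D F 3) :
  let G := cone G0 in
  let X : {set G} := [set Some x1; Some x2; Some x3; Some x4; None]%SET in
  [/\ k_connected 6 G,
      #|G| = n,
      #|edges G| = (4 * n - 11)%N,
      is_rooted 5 X
    & ~ complete_rooted_minor 5 X].
Proof.
have us : uniq [:: x1; x2; x3; x4] by case: hF0_bound => /is_cycle_uniq.
have cV := five_lt_card hconn.
have cE := plane_edge_count (c0 := [:: x1; x2; x3; x4]) hconn hF0 erefl hF0_bound hfaces.
move=> G X; split.
- exact: cone_k_connected.
(* The subtraction in [n - 1] is truncated; the bound [cV] forces [n] to be positive, so [n] is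
   #|G0| + 1. *)
- by rewrite card_cone; move: cV hn; move: #|G0| => V; lia.
(* With V = n - 1 vertices in [G0] the count is (3 V - 7) + V = 4 (n - 1) - 7. *)
- rewrite card_edges_cone; move: cV hn cE; move: #|G0| #|edges G0| => V E; lia.
- have -> : X = [set z in [:: Some x1; Some x2; Some x3; Some x4; None]]%SET.
    by apply/setP => z; rewrite !inE !orbA.
  rewrite /is_rooted cardsE; apply/card_uniqP.
  rewrite -[[:: _; _; _; _; _]]/(rcons (map Some [:: x1; x2; x3; x4]) None) rcons_uniq.
  by rewrite map_inj_uniq ?us ?andbT //; exact: Some_inj.
- move=> /(cone_rooted_minor_paths us) [W13 [W24 [[c13 c24 dj] [h1 h3 h2 h4]]]].
  exact: face_no_crossing hF0 hF0_bound c13 c24 dj h1 h3 h2 h4.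
Qed.
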